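(* Let $M$ be a compact oriented $5$-manifold and let $\rho=\rho(t)=(\rho_1,\rho_2)$ be a family of closed $\mathbf R^2$-valued even forms on $M$, lying at each point in an open orbit of $Spin(5,5)\times GL(2,\mathbf R)$ and satisfying the Hamiltonian flow equation $\partial\rho/\partial t=d\hat\rho$. Let $v_1,h,v_2$ be the ($t$-dependent) sections of $T\oplus T^*$ over $M$ defined by $Q(\rho_1+z\rho_2)=\phi(\rho)\otimes(v_1+2zh+z^2v_2)$, and put $v(z)=v_1+2zh+z^2v_2$ and $u(z)=z^{-1}v_1-zv_2$. On the six-manifold $\mathbf R\times M$ consider the two sections of $T\oplus T^*$ $$v(z),\qquad w(z)=\frac{\partial}{\partial t}-2dt-u(z).$$ Then the rank $2$ subbundle $E_z\subset T\oplus T^*$ spanned at each point by $v(z),w(z)$ is isotropic and Courant-integrable. (This is also valid for $z=0$ and $z=\infty$, where $u(z)$ is replaced by $u(z)-z^{-1}v(z)$, a polynomial in $z$, respectively by $u(z)+z^{-1}v(z)$, a polynomial in $z^{-1}$.)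
   Context: On any manifold, $T\oplus T^*$ has the inner product with $(X+\xi,X+\xi)=i_X\xi$ and acts on forms by Clifford multiplication $(X+\xi)\cdot\varphi=i_X\varphi+\xi\wedge\varphi$. The Courant bracket is $[X+\xi,Y+\eta]=[X,Y]+\mathcal L_X\eta-\mathcal L_Y\xi-\frac12d(i_X\eta-i_Y\xi)$. A subbundle is isotropic if the inner product vanishes on it; an isotropic subbundle $E_z$ is Courant-integrable if the Courant bracket of any two sections of $E_z$ lies in $E_z$. On a $5$-manifold the half-spin spaces of $Spin(T\oplus T^* )\cong Spin(5,5)$ are realized as $\Lambda^{ev}T^*$ and $\Lambda^{od}T^*$, paired by $\langle\varphi_1,\varphi_2\rangle=[\varphi_1\wedge s(\varphi_2)]_5\in\Lambda^5T^*$ (the degree $5$ part), where $s(\alpha)=(-1)^m\alpha$ for $\alpha$ of degree $2m$ or $2m+1$. For an even form $\varphi$, $Q(\varphi)\in\Lambda^5T^*\otimes(T\oplus T^* )$ is defined by $(Q(\varphi),v)=\langle v\cdot\varphi,\varphi\rangle$ for all $v\in T\oplus T^*$. For $\rho=(\rho_1,\rho_2)\in\Lambda^{ev}T^*\otimes\mathbf R^2$ put $f(\rho)=(Q(\rho_1),Q(\rho_2))\in(\Lambda^5T^* )^2$. $Spin(5,5)\times GL(2,\mathbf R)$ acts on $\Lambda^{ev}T^*\otimes\mathbf R^2$ at each point with open orbits, on which $f\neq0$. The invariant volume form is $\phi(\rho)=|f(\rho)|^{1/2}$, the positive square root relative to the orientation. The $\mathbf R^2$-valued odd form $\hat\rho=(\hat\rho_1,\hat\rho_2)$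 is defined by $D\phi(\dot\rho)=\langle\hat\rho_2,\dot\rho_1\rangle-\langle\hat\rho_1,\dot\rho_2\rangle$ for all $\dot\rho$, where $D\phi$ is the derivative of $\phi$ at $\rho$. The flow $\partial\rho/\partial t=d\hat\rho$ is the Hamiltonian flow of the volume functional $\int_M\phi(\rho)$ on a fixed cohomology class.
   Formalization: The formal theorem assumes f(ρ)<0 at every point: where f(ρ)>0 one has (v1,v2)=1 and (w(z),w(z))=-4, so E_z is never isotropic (e.g. ρ1=1+dx1234, ρ2=dx1235+dx45 on the torus T^5, with f=8). *)

(* Defs.v *)
(* MathComp-Analysis, over an arbitrary R : realType. *)
From HB Require Import structures.
From mathcomp Require Import all_boot all_order all_algebra.
From mathcomp Require Import all_classical all_reals all_analysis.
Set Implicit Arguments.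
Unset Strict Implicit.
Unset Printing Implicit Defensive.
Import Order.TTheory GRing.Theory Num.Theory numFieldNormedType.Exports.
Local Open Scope ring_scope.

(** ** Exterior algebra of the dual of R^n, and T + T^* *)

(* phi : extform R n stands for \sum_S phi S *: dx_S, where
   dx_S = dx_(i1) /\ ... /\ dx_(ik) for S = {i1 < ... < ik}. *)
Definition extform (R : realType) (n : nat) := {ffun {set 'I_n} -> R^o}.

(* (X, xi) stands for X + xi, with X and xi given by their coordinates in the
   bases d/dx_i and dx_i. *)
Definition gvec (R : realType) (n : nat) := ('rV[R]_n * 'rV[R]_n)%type.

Section LinearAlgebra.
Variables (R : realType) (n : nat).
Implicit Types (phi psi : extform R n) (v w : gvec R n) (S A B : {set 'I_n}).

(* dx_A /\ dx_B = wsign A B *: dx_(A :|: B) for disjoint A and B *)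
Definition wsign A B : R :=
  (-1) ^+ #|[set p : 'I_n * 'I_n | [&& p.1 \in A, p.2 \in B & (p.2 < p.1)%N]]|.

Definition wedge phi psi : extform R n :=
  [ffun S : {set 'I_n} => \sum_(A : {set 'I_n} | A \subset S)
               wsign A (S :\: A) * phi A * psi (S :\: A)].

Definition unitform : extform R n := [ffun S : {set 'I_n} => (S == finset.set0)%:R].

Definition oneform (xi : 'rV[R]_n) : extform R n :=
  [ffun S : {set 'I_n} => \sum_(i | S == [set i]) xi 0 i].

(* interior product i_X phi *)
Definition contract (X : 'rV[R]_n) phi : extform R n :=
  [ffun S : {set 'I_n} => \sum_(i | i \notin S) X 0 i * (wsign [set i] S * phi (i |: S))].

Definition clifford v phi : extform R n :=
  contract v.1 phi + wedge (oneform v.2) phi.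

(* the symmetric bilinear form polarizing (X + xi, X + xi) = i_X xi *)
Definition ip v w : R :=
  2^-1 * \sum_i (v.1 0 i * w.2 0 i + w.1 0 i * v.2 0 i).

Definition even_form phi := forall S, odd #|S| -> phi S = 0.
Definition odd_form phi := forall S, ~~ odd #|S| -> phi S = 0.

(* (-1)^m on degrees 2m and 2m+1 *)
Definition mukai_s phi : extform R n := [ffun S : {set 'I_n} => (-1) ^+ (#|S|./2) * phi S].

(* <phi, psi>, as a coefficient of dx_1 /\ ... /\ dx_n *)
Definition mukai phi psi : R := wedge phi (mukai_s psi) [set: 'I_n].

(* Q(phi), as a coefficient of dx_1 /\ ... /\ dx_n; see quadP *)
Definition quad phi : gvec R n :=
  (\row_i (2 * mukai (clifford (0, delta_mx 0 i) phi) phi),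
   \row_i (2 * mukai (clifford (delta_mx 0 i, 0) phi) phi)).

(* pullback of constant-coefficient forms under the linear map with Jacobian
   matrix J, J k l = dy_k / dx_l: it sends dy_k to \sum_l J k l dx_l *)
Definition pullback (J : 'M[R]_n) phi : extform R n :=
  \sum_(S : {set 'I_n})
    phi S *: \big[wedge/unitform]_(k <- enum S) oneform (row k J).

Lemma oneformE (xi : 'rV[R]_n) :
  oneform xi = \sum_i xi 0 i *: oneform (delta_mx 0 i).
Proof.
apply/ffunP => S; rewrite sum_ffunE ffunE big_mkcond; apply: eq_bigr => i _.
rewrite !ffunE; case: ifPn => [/eqP -> | Si].
  rewrite (big_pred1 i) => [|j]; last by rewrite (inj_eq set1_inj) eq_sym.
  by rewrite mxE !eqxx /GRing.scale/= mulr1.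
rewrite big1 ?scaler0// => j /eqP Sj; rewrite mxE eqxx/=.
by case: eqP => // ji; rewrite Sj ji eqxx in Si.
Qed.

Lemma wedge_suml (I : Type) (r : seq I) (c : I -> R) (F : I -> extform R n)
    (psi : extform R n) :
  wedge (\sum_(i <- r) c i *: F i) psi = \sum_(i <- r) c i *: wedge (F i) psi.
Proof.
apply/ffunP => S; rewrite sum_ffunE ffunE.
under eq_bigr do rewrite sum_ffunE mulr_sumr mulr_suml.
rewrite exchange_big/=; apply: eq_bigr => i _.
rewrite !ffunE /GRing.scale/= mulr_sumr; apply: eq_bigr => A _.
by rewrite ffunE /GRing.scale/= !mulrA (mulrC (wsign _ _)).
Qed.

Lemma wedgeDl phi psi chi : wedge (phi + psi) chi = wedge phi chi + wedge psi chi.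
Proof.
apply/ffunP => S; rewrite !ffunE -big_split; apply: eq_bigr => A _ /=.
by rewrite ffunE mulrDr mulrDl.
Qed.

Lemma contractE (X : 'rV[R]_n) phi :
  contract X phi = \sum_i X 0 i *: contract (delta_mx 0 i) phi.
Proof.
apply/ffunP => S; rewrite sum_ffunE ffunE big_mkcond; apply: eq_bigr => i _.
rewrite !ffunE /GRing.scale/=; case: ifPn => iS.
  rewrite (bigD1 i)//= big1 ?addr0; last first.
    by move=> j /andP[_ /negbTE ji]; rewrite mxE eqxx ji mul0r.
  by rewrite mxE !eqxx mul1r.
rewrite big1 ?mulr0// => j jS; rewrite mxE eqxx/=.
by case: eqP => [ji|_]; [rewrite -ji jS in iS | rewrite mul0r].
Qed.

Lemma mukai_sum (I : Type) (r : seq I) (c : I -> R) (F : I -> extform R n)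
    (psi : extform R n) :
  mukai (\sum_(i <- r) c i *: F i) psi = \sum_(i <- r) c i * mukai (F i) psi.
Proof.
rewrite /mukai wedge_suml sum_ffunE.
by apply: eq_bigr => i _; rewrite ffunE.
Qed.

Lemma oneform0 : oneform 0 = 0.
Proof. by apply/ffunP => S; rewrite !ffunE big1// => i _; rewrite mxE. Qed.

Lemma contract0 phi : contract 0 phi = 0.
Proof. by apply/ffunP => S; rewrite !ffunE big1// => i _; rewrite mxE mul0r. Qed.

Lemma wedge0 phi : wedge 0 phi = 0.
Proof.
by apply/ffunP => S; rewrite !ffunE big1// => A _; rewrite ffunE mulr0 mul0r.
Qed.

Lemma quadP phi v : ip (quad phi) v = mukai (clifford v phi) phi.
Proof.
have -> : mukai (clifford v phi) phi =
    mukai (contract v.1 phi) phi + mukai (wedge (oneform v.2) phi) phi.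
  by rewrite /mukai wedgeDl ffunE.
rewrite contractE oneformE wedge_suml !mukai_sum /ip mulr_sumr -big_split.
apply: eq_bigr => i _; rewrite !mxE /clifford/= oneform0 wedge0 addr0.
rewrite contract0 add0r mulrDr !mulrA mulVf ?pnatr_eq0// mul1r addrC.
by rewrite -(mulrA _ _ 2) mulrCA mulVf ?pnatr_eq0// mulr1 (mulrC (mukai _ _)).
Qed.

End LinearAlgebra.

(** ** Pairs of even forms on R^5 *)

Local Open Scope classical_set_scope.

Section Pairs.
Variables (R : realType).
Local Notation form2 := (extform R 5 * extform R 5)%type.
Implicit Types (rho : form2) (vs : seq (gvec R 5)).

Definition even2 rho := even_form rho.1 /\ even_form rho.2.
Definition odd2 rho := odd_form rho.1 /\ odd_form rho.2.

(* Spin(5,5) consists of the Clifford products of evenly many vectors of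
   square 1 or -1. *)
Definition spin_word vs :=
  ~~ odd (size vs) && all (fun v => (ip v v == 1) || (ip v v == -1)) vs.

Definition spin_act vs (phi : extform R 5) := foldr (@clifford R 5) phi vs.

Definition gl2_act (A : 'M[R]_2) rho : form2 :=
  (A 0 0 *: rho.1 + A 0 1 *: rho.2, A 1 0 *: rho.1 + A 1 1 *: rho.2).

Definition orbit rho : set form2 :=
  [set sigma | exists vs, exists A : 'M[R]_2, [/\ spin_word vs, A \in unitmx
     & sigma = gl2_act A (spin_act vs rho.1, spin_act vs rho.2)]].

(* the orbit of rho is open in the 32-dimensional space of pairs of even forms *)
Definition open_orbit rho :=
  forall sigma, orbit rho sigma -> exists2 e : R, 0 < e &
    forall tau, even2 tau ->
      (forall S, `|tau.1 S - sigma.1 S| < e /\ `|tau.2 S - sigma.2 S| < e) ->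
      orbit rho tau.

(* f(rho) and phi(rho), as coefficients of (dx_1 /\ ... /\ dx_5)^2 and
   dx_1 /\ ... /\ dx_5; for phi the coordinates must be positively oriented *)
Definition quartic rho : R := ip (quad rho.1) (quad rho.2).
Definition vol rho : R := Num.sqrt `|quartic rho|.

(* rhat is the odd pair representing the derivative of vol at rho *)
Definition is_hat rho (rhat : form2) :=
  odd2 rhat /\ forall drho, even2 drho ->
    is_derive (0 : R) (1 : R) (fun e : R => vol (rho + e *: drho))
      (mukai rhat.2 drho.1 - mukai rhat.1 drho.2).

End Pairs.

(** ** Calculus on open subsets of R^n *)

Section Calculus.
Variables (R : realType) (n : nat).

Definition partial (i : 'I_n) (f : 'rV[R]_n -> R) (x : 'rV[R]_n) : R :=
  'D_(delta_mx 0 i) f x.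

Fixpoint Ck (k : nat) (U : set 'rV[R]_n) (f : 'rV[R]_n -> R) : Prop :=
  if k is k'.+1 then
    (forall x, U x -> differentiable f x) /\ forall i, Ck k' U (partial i f)
  else forall x, U x -> {for x, continuous f}.

Definition smooth_on (U : set 'rV[R]_n) (f : 'rV[R]_n -> R) :=
  forall k, Ck k U f.

Definition jac (g : 'rV[R]_n -> 'rV[R]_n) (x : 'rV[R]_n) : 'M[R]_n :=
  \matrix_(k, l) partial l (fun y => g y 0 k) x.

Definition ext_d (phi : 'rV[R]_n -> extform R n) (x : 'rV[R]_n) : extform R n :=
  [ffun S : {set 'I_n} => \sum_(j in S) wsign R [set j]%SET (S :\ j) *
               partial j (fun y => phi y (S :\ j)) x].

Definition lie_bracket (X Y : 'rV[R]_n -> 'rV[R]_n) (x : 'rV[R]_n) : 'rV[R]_n :=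
  \row_k \sum_j (X x 0 j * partial j (fun y => Y y 0 k) x
                 - Y x 0 j * partial j (fun y => X y 0 k) x).

(* Lie derivative of the 1-form xi along X *)
Definition lie_form (X xi : 'rV[R]_n -> 'rV[R]_n) (x : 'rV[R]_n) : 'rV[R]_n :=
  \row_k \sum_j (X x 0 j * partial j (fun y => xi y 0 k) x
                 + xi x 0 j * partial k (fun y => X y 0 j) x).

Definition grad (f : 'rV[R]_n -> R) (x : 'rV[R]_n) : 'rV[R]_n :=
  \row_k partial k f x.

Definition courant (a b : 'rV[R]_n -> gvec R n) (x : 'rV[R]_n) : gvec R n :=
  let X := fun y => (a y).1 in let xi := fun y => (a y).2 in
  let Y := fun y => (b y).1 in let eta := fun y => (b y).2 in
  (lie_bracket X Y x,
   lie_form X eta x - lie_form Y xi x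
   - 2^-1 *: grad (fun y => \sum_i (X y 0 i * eta y 0 i - Y y 0 i * xi y 0 i)) x).

End Calculus.

(** ** Manifolds, through an atlas *)

(* dom i is the domain of the chart coord i, and param i is its inverse.
   Values of coord i outside dom i, and of param i outside of the image of
   the chart, are irrelevant. *)
Record charted (R : realType) (n : nat) := Charted {
  points :> topologicalType;
  chart : Type;
  dom : chart -> set points;
  coord : chart -> points -> 'rV[R]_n;
  param : chart -> 'rV[R]_n -> points }.

Section Manifold.
Variables (R : realType) (n : nat) (M : charted R n).
Implicit Types (i j : chart M) (x : 'rV[R]_n).

Definition img i : set 'rV[R]_n := coord i @` dom i.
Definition overlap i j : set 'rV[R]_n := coord i @` (dom i `&` dom j).
Definition transition i j : 'rV[R]_n -> 'rV[R]_n := coord j \o param i.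

Record smooth_manifold : Prop := SmoothManifold {
  hausdorffM : hausdorff_space M;
  second_countableM : second_countable (T := M);
  chart_cover : forall p : M, exists i, dom i p;
  open_dom : forall i, open (dom i);
  open_img : forall i, open (img i);
  coordK : forall i p, dom i p -> param i (coord i p) = p;
  continuous_coord : forall i p, dom i p -> {for p, continuous (coord i)};
  continuous_param : forall i x, img i x -> {for x, continuous (param i)};
  smooth_transition : forall i j (k : 'I_n),
    smooth_on (overlap i j) (fun x => transition i j x 0 k) }.

Definition oriented :=
  forall i j x, overlap i j x -> 0 < \det (jac (transition i j) x).

(* A field is given by its components in every chart; these only matter on
   the image of the chart. *)
Definition form_field := chart M -> 'rV[R]_n -> extform R n.
Definition gen_field := chart M -> 'rV[R]_n -> gvec R n.

Definition form_compatible (phi : form_field) :=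
  forall i j x, overlap i j x ->
    phi i x = pullback (jac (transition i j) x) (phi j (transition i j x)).

Definition gen_compatible (a : gen_field) :=
  forall i j x, overlap i j x ->
    let y := transition i j x in let J := jac (transition i j) x in
    (a j y).1 = (a i x).1 *m J^T /\ (a i x).2 = (a j y).2 *m J.

(* smooth sections of T + T^* *)
Definition gen_section (a : gen_field) :=
  gen_compatible a /\
  forall i (k : 'I_n), smooth_on (img i) (fun x => (a i x).1 0 k) /\
                       smooth_on (img i) (fun x => (a i x).2 0 k).

Definition closed_field (phi : form_field) :=
  forall i x, img i x -> ext_d (phi i) x = 0.

(* a field of subspaces of T + T^* *)
Definition gen_subbundle := chart M -> 'rV[R]_n -> {vspace gvec R n}.

Definition has_rank (r : nat) (E : gen_subbundle) :=
  forall i x, img i x -> \dim (E i x) = r.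

Definition isotropic (E : gen_subbundle) :=
  forall i x, img i x -> forall a b, a \in E i x -> b \in E i x -> ip a b = 0.

Definition section_of (E : gen_subbundle) (a : gen_field) :=
  gen_section a /\ forall i x, img i x -> a i x \in E i x.

Definition courant_integrable (E : gen_subbundle) :=
  forall a b, section_of E a -> section_of E b ->
    forall i x, img i x -> courant (a i) (b i) x \in E i x.

(** *** The product R x M and time-dependent fields on M *)

(* coordinates on R x M: time first *)
Definition time (y : 'rV[R]_(1 + n)) : R := lsubmx y 0 0.
Definition space (y : 'rV[R]_(1 + n)) : 'rV[R]_n := rsubmx y.

Definition cylinder : charted R (1 + n) :=
  @Charted R (1 + n) (R * M)%type (chart M)
    (fun i => [set p | dom i p.2])
    (fun i p => row_mx (const_mx p.1) (coord i p.2))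
    (fun i y => (time y, param i (space y))).

Definition ddt : gvec R (1 + n) := (row_mx (const_mx 1) 0, 0).
Definition dt : gvec R (1 + n) := (0, row_mx (const_mx 1) 0).
Definition lift_gvec (a : gvec R n) : gvec R (1 + n) :=
  (row_mx 0 a.1, row_mx 0 a.2).

(* smooth in time and space jointly *)
Definition form_family (phi : R -> form_field) :=
  (forall t, form_compatible (phi t)) /\
  forall i S, smooth_on [set y | img i (space y)]
                (fun y => phi (time y) i (space y) S).

Definition gen_family (a : R -> gen_field) :=
  (forall t, gen_compatible (a t)) /\
  forall i (k : 'I_n),
    smooth_on [set y | img i (space y)]
      (fun y => (a (time y) i (space y)).1 0 k) /\
    smooth_on [set y | img i (space y)]
      (fun y => (a (time y) i (space y)).2 0 k).

End Manifold.

(* the subbundle of T + T^* over R x M spanned at each point by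
   v and d/dt - 2 dt - u, where v and u are sections over M depending on t *)
Definition spanE (R : realType) (n : nat) (M : charted R n)
    (v u : R -> gen_field M) : gen_subbundle (cylinder M) :=
  fun i y =>
    let p := v (time y) i (space y) in let q := u (time y) i (space y) in
    <<[:: lift_gvec p; ddt R n - 2 *: dt R n - lift_gvec q]>>%VS.

(** ** The families v(z) and u(z) *)

Section Pencil.
Variables (R : realType) (V : lmodType R).
Implicit Types (z s : R) (v h : V).

Definition vz z v1 h v2 := v1 + (2 * z) *: h + z ^+ 2 *: v2.
Definition uz z v1 v2 := z^-1 *: v1 - z *: v2.

(* u(z) - z^-1 v(z), extended to z = 0 *)
Definition uz_at0 z h v2 := - (2 *: h) - (2 * z) *: v2.

(* z^-2 v(z) and u(z) + z^-1 v(z) as functions of s = z^-1, extended to s = 0 *)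
Definition vz_atoo s v1 h v2 := s ^+ 2 *: v1 + (2 * s) *: h + v2.
Definition uz_atoo s v1 h := (2 * s) *: v1 + 2 *: h.

Lemma uz_at0E z v1 h v2 : z != 0 ->
  uz z v1 v2 - z^-1 *: vz z v1 h v2 = uz_at0 z h v2.
Proof.
move=> z0; rewrite /uz /vz /uz_at0 !scalerDr !scalerA.
rewrite (mulrCA _ 2) mulVf// mulr1 expr2 mulrA mulVf// mul1r.
have key (a b c : V) : a - b - (a + c + b) = - c - (b + b).
  by rewrite -[a + c + b]addrA opprD addrA [a - b]addrC addrK -opprD addrCA opprD.
by rewrite key -scalerDl mulr_natl mulr2n.
Qed.

Lemma vz_atooE z v1 h v2 : z != 0 ->
  z^-1 ^+ 2 *: vz z v1 h v2 = vz_atoo z^-1 v1 h v2.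
Proof.
move=> z0; rewrite /vz /vz_atoo !scalerDr !scalerA -exprMn mulVf// expr1n.
by rewrite scale1r expr2 (mulrCA _ 2) -(mulrA z^-1 z^-1) mulVf// mulr1.
Qed.

Lemma uz_atooE z v1 h v2 : z != 0 ->
  uz z v1 v2 + z^-1 *: vz z v1 h v2 = uz_atoo z^-1 v1 h.
Proof.
move=> z0; rewrite /uz /vz /uz_atoo !scalerDr !scalerA.
rewrite (mulrCA _ 2) mulVf// mulr1 expr2 mulrA mulVf// mul1r.
have key (a b c : V) : a - b + (a + c + b) = a + a + c.
  by rewrite addrC [a - b]addrC addrA addrK addrAC.
by rewrite key -scalerDl mulr_natl mulr2n.
Qed.

End Pencil.

(* Main.v *)
(** Write [s = rho1 + z rho2], and [v], [u] for [v(z)], [u(z)]. A spinor in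
dimension [5 + 5] satisfies [(Q s, Q s) = 0], hence [Q(s).s = 0] by
polarization; so [v] is null and [v.s = 0], for every [z]. Comparing powers of
[z] gives [(v1, h) = (h, v2) = 0] and [2 (h, h) = - (v1, v2) = 1], whence
[(u, v) = 0] and [(u, u) = 2], which is the isotropy of [E_z]. Differentiating
[phi^2 = - f] gives [hat rho1 = v1.rho2] and [hat rho2 = - v2.rho1], so that
[u.s = hat rho1 + z hat rho2] and the flow reads [ds/dt = d(u.s)].

The Courant bracket on the cylinder is
[[v, w] = 2 (v, u_t) dt - ([v, u] + v_t)], where the right hand bracket is that
of [M]. As [v.s = 0] and [ds = 0], one has [[v, u].s = v.d(u.s) = v.s_t], which
is [- v_t.s]. So [[v, u] + v_t] annihilates [s], and is a multiple of [v]
because the annihilator of a spinor [s] with [Q s <> 0] is spanned by [Q s].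
Finally [- phi (v, u_t) = 2 <u.s, s_t> = 2 <u.s, d(u.s)>] is half the divergence
of the vector part of [Q(u.s) = - 2 Q s], which vanishes because [s] is closed.
The values [z = 0, oo] correspond to [s = rho1, rho2]. *)

Require Import Defs.
From HB Require Import structures.
From mathcomp Require Import all_boot all_order all_algebra.
From mathcomp Require Import all_classical all_reals all_analysis.
From mathcomp Require Import ring lra zify.
Import Order.TTheory GRing.Theory Num.Theory numFieldNormedType.Exports.
Local Open Scope ring_scope.

Set Implicit Arguments.
Unset Strict Implicit.

(** * Clifford algebra of exterior forms *)

Section Clifford.
Variables (R : realType) (n : nat).
Implicit Types (i j : 'I_n) (S A B C : {set 'I_n}) (v w : gvec R n).
Implicit Types (phi psi : extform R n).

(** The exponent in [wsign], as a double sum over all indices so that it splits termwise over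
    disjoint unions. *)
Definition inversions A B : nat := (\sum_i \sum_j [&& i \in A, j \in B & j < i])%N.

Lemma wsignE A B : wsign R A B = (-1) ^+ inversions A B.
Proof.
rewrite /wsign /inversions; congr (_ ^+ _).
by rewrite pair_big -sum1_card big_mkcond; apply: eq_bigr => p _; rewrite inE; case: ifP.
Qed.

Lemma inversionsUl A B C : [disjoint A & B]%B ->
  inversions (A :|: B) C = (inversions A C + inversions B C)%N.
Proof.
move=> AB; rewrite /inversions -big_split; apply: eq_bigr => i _ /=.
rewrite -big_split; apply: eq_bigr => j _; rewrite inE.
have := disjointFr AB; move/(_ i); case: (i \in A) => [->//|_] /=; first by rewrite addn0.
by rewrite add0n.
Qed.

Lemma inversionsUr A B C : [disjoint B & C]%B ->
  inversions A (B :|: C) = (inversions A B + inversions A C)%N.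
Proof.
move=> BC; rewrite /inversions -big_split; apply: eq_bigr => i _ /=.
rewrite -big_split; apply: eq_bigr => j _; rewrite inE.
have := disjointFr BC; move/(_ j); case: (j \in B) => [->//|_] /=.
  by case: (_ \in _); rewrite ?addn0.
by rewrite andbF.
Qed.

Lemma inversions1l i B : inversions [set i] B = (\sum_(j in B) (j < i))%N.
Proof.
rewrite /inversions (bigD1 i)//= [X in (_ + X)%N]big1 ?addn0 => [|k /negbTE ki]; last first.
  by rewrite big1// => j _; rewrite inE ki.
by rewrite [RHS]big_mkcond; apply: eq_bigr => j _; rewrite inE eqxx; case: ifP.
Qed.

Lemma inversions1r A i : inversions A [set i] = (\sum_(j in A) (i < j))%N.
Proof.
rewrite /inversions [RHS]big_mkcond; apply: eq_bigr => k _.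
rewrite (bigD1 i)//= big1 ?addn0 => [|j /negbTE ji]; last first.
  by rewrite inE ji andbF.
by rewrite inE eqxx; case: ifP.
Qed.

Lemma inversions_flip A i : i \notin A ->
  (inversions A [set i] + inversions [set i] A)%N = #|A|.
Proof.
move=> iA; rewrite inversions1l inversions1r -big_split -sum1_card.
apply: eq_bigr => j jA /=.
have : j != i by apply: contraNneq iA => <-.
by rewrite -(inj_eq val_inj)/=; case: ltngtP.
Qed.

(** A pair from two disjoint sets is inverted in exactly one of the two orders. *)
Lemma inversionsC A B : [disjoint A & B]%B ->
  (inversions A B + inversions B A = #|A| * #|B|)%N.
Proof.
move=> AB; rewrite /inversions [X in (_ + X)%N]exchange_big -big_split /=.
rewrite -!sum1_card big_distrl/= [RHS]big_mkcond; apply: eq_bigr => i _.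
rewrite -big_split mul1n [in RHS]big_mkcond; case: ifPn => iA /=; last first.
  by rewrite big1// => j _; rewrite andbF.
apply: eq_bigr => j _; case: ifPn => //= jB.
have : j != i by apply: contraTneq jB => ->; rewrite (disjointFr AB).
by rewrite -(inj_eq val_inj)/=; case: ltngtP.
Qed.

(** The symmetric difference with {i}. Contraction with d/dx_i and exterior multiplication by dx_i
    both relate the coefficients at S and at [toggle i S], so the two halves of the Clifford action
    get a uniform description. *)
Definition toggle i S := if i \in S then S :\ i else i |: S.

Lemma in_toggle i j S : (j \in toggle i S) = (j == i) (+) (j \in S).
Proof.
by rewrite /toggle; case: ifP => iS; rewrite !inE; case: eqP => [->|] //=; rewrite ?iS.
Qed.

Lemma toggleK i : involutive (toggle i).
Proof. by move=> S; apply/setP => j; rewrite !in_toggle addbA addbb. Qed.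

Lemma toggleC i j S : toggle i (toggle j S) = toggle j (toggle i S).
Proof. by apply/setP => k; rewrite !in_toggle addbCA. Qed.

Lemma setC_toggle i S : ~: toggle i S = toggle i (~: S).
Proof. by apply/setP => k; rewrite !(inE, in_toggle) addbN. Qed.

Lemma odd_toggle i S : odd #|toggle i S| = ~~ odd #|S|.
Proof.
rewrite /toggle; case: ifPn => iS; last by rewrite cardsU1 iS.
by rewrite (cardsD1 i S) iS /= negbK.
Qed.

Definition eps i S : R := wsign R [set i] S.

(** [eps j S] is the parity of the number of elements of S below j, which toggling i changes exactly
    when i < j. *)
Lemma eps_toggle i j S : eps j (toggle i S) = (-1) ^+ (i < j)%N * eps j S.
Proof.
rewrite /eps !wsignE -exprD.
wlog iS : S / i \notin S => [H|].
  case: (boolP (i \in S)) => iS; last exact: H.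
  have := H (toggle i S); rewrite toggleK in_toggle eqxx iS => /(_ isT) E.
  by rewrite exprD E exprD mulrA -signr_addb addbb mul1r.
by rewrite /toggle (negbTE iS) !inversions1l big_setU1//=.
Qed.

Lemma eps2 i S : eps i S * eps i S = 1.
Proof. by rewrite /eps wsignE -signr_odd -signr_addb addbb. Qed.

(** The component of v at i that enters the coefficient of [clifford v phi] at S, where b tells
    whether i lies in S: wedging must have added i, or contraction removed it. *)
Definition coef v i (b : bool) : R := if b then v.2 0 i else v.1 0 i.

Lemma cliffordE v phi S :
  clifford v phi S = \sum_i coef v i (i \in S) * (eps i S * phi (toggle i S)).
Proof.
rewrite !ffunE /= big_mkcond.
under [X in _ + X]eq_bigr do rewrite ffunE mulr_sumr mulr_suml.
rewrite (exchange_big_dep (mem S))/=; last first.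
  by move=> A i AS /eqP A1; rewrite -finset.sub1set -A1.
rewrite [X in _ + X]big_mkcond -big_split; apply: eq_bigr => i _ /=.
rewrite /toggle /coef; case: (boolP (i \in S)) => iS /=; last by rewrite addr0.
rewrite (big_pred1 [set i]) => [|A] /=; last first.
  by case: eqP => [->|]; rewrite ?finset.sub1set ?iS ?andbF.
rewrite add0r (mulrC (wsign R _ _)) -mulrA; congr (_ * (_ * _)).
have -> : S :\ i = toggle i S by rewrite /toggle iS.
by rewrite -/(eps i _) eps_toggle ltnn mul1r.
Qed.

Lemma cliffordDl v w phi : clifford (v + w) phi = clifford v phi + clifford w phi.
Proof.
apply/ffunP => S; rewrite [RHS]ffunE !cliffordE -big_split.
by apply: eq_bigr => i _; rewrite /coef; case: ifP; rewrite mxE mulrDl.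
Qed.

Lemma cliffordZl (a : R) v phi : clifford (a *: v) phi = a *: clifford v phi.
Proof.
apply/ffunP => S; rewrite [RHS]ffunE !cliffordE [RHS]scaler_sumr.
by apply: eq_bigr => i _; rewrite /coef; case: ifP => _; rewrite mxE -mulrA.
Qed.

Lemma cliffordDr v phi psi : clifford v (phi + psi) = clifford v phi + clifford v psi.
Proof.
apply/ffunP => S; rewrite [RHS]ffunE !cliffordE -big_split.
by apply: eq_bigr => i _; rewrite ffunE !mulrDr.
Qed.

Lemma cliffordZr (a : R) v phi : clifford v (a *: phi) = a *: clifford v phi.
Proof.
apply/ffunP => S; rewrite [RHS]ffunE !cliffordE [RHS]scaler_sumr.
apply: eq_bigr => i _; rewrite ffunE /GRing.scale/=; ring.
Qed.

Lemma clifford0l phi : clifford 0 phi = 0.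
Proof. by have := cliffordZl 0 0 phi; rewrite !scale0r. Qed.

Lemma clifford0r v : clifford v 0 = 0.
Proof. by have := cliffordZr 0 v 0; rewrite !scale0r. Qed.

Lemma ipC v w : ip v w = ip w v.
Proof. by rewrite /ip; congr (_ * _); apply: eq_bigr => i _; rewrite addrC. Qed.

Lemma ipDl v v' w : ip (v + v') w = ip v w + ip v' w.
Proof.
rewrite /ip -mulrDr -big_split; congr (_ * _); apply: eq_bigr => i _ /=.
by rewrite !mxE; ring.
Qed.

Lemma ipZl (a : R) v w : ip (a *: v) w = a * ip v w.
Proof.
rewrite /ip mulrCA; congr (_ * _); rewrite mulr_sumr; apply: eq_bigr => i _ /=.
by rewrite !mxE; ring.
Qed.

Lemma ipNl v w : ip (- v) w = - ip v w.
Proof. by rewrite -scaleN1r ipZl mulN1r. Qed.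

Lemma ipBl v v' w : ip (v - v') w = ip v w - ip v' w.
Proof. by rewrite ipDl ipNl. Qed.

Lemma ipDr v w w' : ip v (w + w') = ip v w + ip v w'.
Proof. by rewrite !(ipC v) ipDl. Qed.

Lemma ipZr (a : R) v w : ip v (a *: w) = a * ip v w.
Proof. by rewrite !(ipC v) ipZl. Qed.

Lemma ipNr v w : ip v (- w) = - ip v w.
Proof. by rewrite !(ipC v) ipNl. Qed.

Lemma ipBr v w w' : ip v (w - w') = ip v w - ip v w'.
Proof. by rewrite !(ipC v) ipBl. Qed.

Lemma ip0l w : ip 0 w = 0.
Proof. by rewrite -(scale0r 0) ipZl mul0r. Qed.

Lemma ip_nondeg v : (forall w, ip v w = 0) -> v = 0.
Proof.
move=> v0; have E1 i : v.1 0 i = 0.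
  have := v0 (0, delta_mx 0 i); rewrite /ip (bigD1 i)//= big1 ?mxE ?eqxx.
    by rewrite mulr1 mul0r !addr0 => /eqP; rewrite mulf_eq0 invr_eq0 pnatr_eq0 => /eqP.
  by move=> j /negbTE ji; rewrite !mxE eqxx ji mulr0 mul0r addr0.
have E2 i : v.2 0 i = 0.
  have := v0 (delta_mx 0 i, 0); rewrite /ip (bigD1 i)//= big1 ?mxE ?eqxx.
    by rewrite mulr0 mul1r !add0r addr0 => /eqP; rewrite mulf_eq0 invr_eq0 pnatr_eq0 => /eqP.
  by move=> j /negbTE ji; rewrite !mxE eqxx ji mulr0 mul0r addr0.
case: v v0 E1 E2 => a b _ /= E1 E2; congr pair; apply/rowP => i; by rewrite mxE.
Qed.

(** By nondegeneracy. Pairing with a test vector turns identities in T + T^* into scalar ones. *)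
Lemma ip_ext v w : (forall c, ip v c = ip w c) -> v = w.
Proof.
by move=> vw; apply/eqP; rewrite -subr_eq0; apply/eqP/ip_nondeg => c; rewrite ipBl vw subrr.
Qed.

Lemma ip_suml (I : Type) (r : seq I) (F : I -> gvec R n) w :
  ip (\sum_(i <- r) F i) w = \sum_(i <- r) ip (F i) w.
Proof. exact: (big_morph (fun v => ip v w) (fun v v' => ipDl v v' w) (ip0l w)). Qed.

Lemma ip_oneform (f : 'I_n -> R) w : ip (0, \row_k f k) w = \sum_k 2^-1 * (w.1 0 k * f k).
Proof.
by rewrite /ip mulr_sumr; apply: eq_bigr => k _; rewrite !mxE mul0r add0r.
Qed.

Lemma clifford_suml (I : Type) (r : seq I) (F : I -> gvec R n) phi :
  clifford (\sum_(i <- r) F i) phi = \sum_(i <- r) clifford (F i) phi.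
Proof.
apply: (big_morph (fun v => clifford v phi) (fun v v' => cliffordDl v v' phi)).
exact: clifford0l.
Qed.

Lemma clifford_sumr (I : Type) (r : seq I) v (F : I -> extform R n) :
  clifford v (\sum_(i <- r) F i) = \sum_(i <- r) clifford v (F i).
Proof.
apply: (big_morph (clifford v) (cliffordDr v)).
exact: clifford0r.
Qed.

(** Toggles at distinct indices commute while their signs anticommute, so only the terms i = j
    survive; there one factor is a vector component and the other a form component. *)
Lemma clifford_rel v w phi :
  clifford v (clifford w phi) + clifford w (clifford v phi) = (2 * ip v w) *: phi.
Proof.
apply/ffunP => S; rewrite [LHS]ffunE [RHS]ffunE !cliffordE.
under eq_bigr do rewrite cliffordE mulr_sumr mulr_sumr.
under [X in _ + X]eq_bigr do rewrite cliffordE mulr_sumr mulr_sumr.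
rewrite [X in _ + X]exchange_big -big_split/=.
rewrite /ip mulrA mulfV ?pnatr_eq0// mul1r [RHS]mulr_suml.
apply: eq_bigr => i _; rewrite -big_split (bigD1 i)//= big1 => [|j ji].
  rewrite addr0 !toggleK !eps_toggle ltnn !in_toggle eqxx mul1r /coef.
  rewrite addTb -[phi S in RHS]mul1r -(eps2 i S).
  by case: (i \in S) => /=; ring.
rewrite !eps_toggle !in_toggle (negbTE ji) eq_sym (negbTE ji) /= toggleC.
have -> : (-1) ^+ (j < i)%N = - ((-1) ^+ (i < j)%N) :> R.
  move: ji; rewrite -(inj_eq val_inj)/=.
  by case: ltngtP => //= _ _; rewrite ?expr0 ?expr1 ?opprK.
ring.
Qed.

Lemma clifford_sq v phi : clifford v (clifford v phi) = ip v v *: phi.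
Proof.
have := clifford_rel v v phi; rewrite -mulr2n -scaler_nat -scalerA => /(congr1 (GRing.scale 2^-1)).
by rewrite ![2^-1 *: _]scalerA mulVf ?pnatr_eq0// !scale1r.
Qed.

Lemma clifford_parity v phi : even_form phi -> odd_form (clifford v phi).
Proof.
move=> ev S oS; rewrite cliffordE big1// => i _.
by rewrite ev ?mulr0// odd_toggle.
Qed.

(** The Mukai pairing couples the coefficient at S with the one at the complement of S; this is the
    sign of that term. *)
Definition kappa S : R := wsign R S (~: S) * (-1) ^+ (#|~: S|./2).

Lemma mukaiE phi psi : mukai phi psi = \sum_S kappa S * (phi S * psi (~: S)).
Proof.
rewrite /mukai ffunE; apply: eq_big => [S|S _]; first by rewrite finset.subsetT.
by rewrite ffunE /kappa finset.setTD; ring.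
Qed.

Lemma mukaiDl phi phi' psi : mukai (phi + phi') psi = mukai phi psi + mukai phi' psi.
Proof.
rewrite !mukaiE -big_split; apply: eq_bigr => S _; rewrite /= !ffunE; ring.
Qed.

Lemma mukaiZl (a : R) phi psi : mukai (a *: phi) psi = a * mukai phi psi.
Proof.
rewrite !mukaiE mulr_sumr; apply: eq_bigr => S _.
by rewrite !ffunE /GRing.scale/=; ring.
Qed.

Lemma mukaiDr phi psi psi' : mukai phi (psi + psi') = mukai phi psi + mukai phi psi'.
Proof.
rewrite !mukaiE -big_split; apply: eq_bigr => S _; rewrite /= !ffunE; ring.
Qed.

Lemma mukaiZr (a : R) phi psi : mukai phi (a *: psi) = a * mukai phi psi.
Proof.
rewrite !mukaiE mulr_sumr; apply: eq_bigr => S _.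
by rewrite !ffunE /GRing.scale/=; ring.
Qed.

Lemma mukai0l psi : mukai 0 psi = 0.
Proof. by have := mukaiZl 0 0 psi; rewrite scale0r mul0r. Qed.

Lemma mukai0r phi : mukai phi 0 = 0.
Proof. by have := mukaiZr 0 phi 0; rewrite scale0r mul0r. Qed.

Lemma mukai_sumr (I : Type) (r : seq I) phi (F : I -> extform R n) :
  mukai phi (\sum_(i <- r) F i) = \sum_(i <- r) mukai phi (F i).
Proof. exact: (big_morph (mukai phi) (mukaiDr phi) (mukai0r phi)). Qed.

Definition deltaform S : extform R n := [ffun T : {set 'I_n} => (T == S)%:R].

Lemma mukai_delta phi S : mukai phi (deltaform (~: S)) = kappa S * phi S.
Proof.
rewrite mukaiE (bigD1 S)//= big1 ?addr0 => [|T TS]; first by rewrite ffunE eqxx mulr1.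
by rewrite ffunE (inj_eq (@finset.setC_inj _)) (negbTE TS) !mulr0.
Qed.

Lemma kappa_neq0 S : kappa S != 0.
Proof. by rewrite /kappa wsignE mulf_neq0 // signr_eq0. Qed.

End Clifford.

(** * Spinors in dimension five and the quadratic map Q *)

Section Five.
Variable R : realType.
Implicit Types (i j : 'I_5) (S A B C : {set 'I_5}) (v w c : gvec R 5).
Implicit Types (phi psi : extform R 5).

(** The sign identity behind the self-adjointness of Clifford multiplication. *)
Lemma kappa_toggle i A : kappa R A * eps R i A = kappa R (toggle i A) * eps R i (~: A).
Proof.
wlog iA : A / i \in A => [H|].
  have [/H//|iA] := boolP (i \in A).
  have := H (toggle i A); rewrite toggleK in_toggle eqxx (negbTE iA) => /(_ isT).
  rewrite setC_toggle !eps_toggle ltnn !mul1r => E.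
  have E1 := eps2 R i A; have E2 := eps2 R i (~: A).
  rewrite -[LHS]mulr1 -E2 [LHS]mulrACA -E -[RHS]mulr1 -E1; ring.
rewrite /kappa setC_toggle; set D := ~: A; set C := A :\ i.
have iC : i \notin C by rewrite !inE eqxx.
have iD : i \notin D by rewrite inE negbK.
have AC : A = i |: C by rewrite finset.setD1K.
have -> : toggle i D = i |: D by rewrite /toggle (negbTE iD).
have -> : toggle i A = C by rewrite /toggle iA.
have -> : eps R i A = eps R i C by have := eps_toggle R i i A; rewrite ltnn mul1r /toggle iA => <-.
rewrite {1}AC /eps !wsignE inversionsUl ?disjoints1// inversionsUr ?disjoints1//.
(* C and D partition the four indices other than i, so their sizes have the same parity; this makes
   the two signs match. *)
have cCD : (#|C| + #|D|)%N = 4%N.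
  by have := cardsC A; rewrite (cardsD1 i A) iA card_ord -/C -/D add1n addSn => -[].
rewrite cardsU1 iD add1n.
have H := inversions_flip iC.
rewrite -!exprD -signr_odd -[RHS]signr_odd; congr (_ ^+ _); congr nat_of_bool.
move: H cCD; set a := inversions [set i] D; set b := inversions C D.
set e := inversions C _; set f := inversions _ C.
move: #|C| #|D| => p q; clear; lia.
Qed.

Lemma clifford_adj v phi psi : mukai (clifford v phi) psi = mukai phi (clifford v psi).
Proof.
rewrite !mukaiE.
under eq_bigr do rewrite cliffordE mulr_suml mulr_sumr.
under [RHS]eq_bigr do rewrite cliffordE !mulr_sumr.
rewrite exchange_big [RHS]exchange_big; apply: eq_bigr => i _ /=.
rewrite [RHS](reindex_inj (inv_inj (toggleK i)))/=; apply: eq_bigr => A _.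
rewrite setC_toggle eps_toggle ltnn mul1r toggleK.
have -> : (i \in toggle i (~: A)) = (i \in A) by rewrite in_toggle eqxx inE /= negbK.
have := kappa_toggle i A.
set k := kappa R A; set k' := kappa R (toggle i A) => E.
transitivity (k * eps R i A * (coef v i (i \in A) * (phi (toggle i A) * psi (~: A)))).
  by ring.
by rewrite E; ring.
Qed.

(** Complementation exchanges the two arguments, and the signs agree since p q + p./2 + q./2 is even
    whenever p + q = 5. *)
Lemma mukaiC phi psi : mukai phi psi = mukai psi phi.
Proof.
rewrite !mukaiE [RHS](reindex_inj (@finset.setC_inj _))/=; apply: eq_bigr => A _.
rewrite finset.setCK [psi _ * _]mulrC; congr (_ * _).
rewrite /kappa finset.setCK !wsignE -!exprD -signr_odd -[RHS]signr_odd.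
congr (_ ^+ _); congr nat_of_bool.
have AC : [disjoint A & ~: A]%B
  by rewrite fintype.disjoint_subset; apply/fintype.subsetP => i; rewrite !inE negbK.
have := inversionsC AC; have := cardsC A; rewrite card_ord.
set a := inversions A _; set b := inversions _ A.
move: #|A| #|~: A| => p q; clear; move=> pq.
have {pq} [-> q5] : (p = 5 - q)%N /\ (q < 6)%N by lia.
by move: q q5 => [|[|[|[|[|[|]]]]]] //= _; lia.
Qed.

(* Sets of indices are encoded by bit vectors, on which all signs compute. *)
Definition bset (s : seq bool) : {set 'I_5} := [set i : 'I_5 | nth false s i].
Definition bseqs : seq (seq bool) :=
  foldr (fun _ r => [seq b :: t | b <- [:: false; true], t <- r]) [:: [::]] (iota 0 5).
(** A conditional instead of a power of -1, so that evaluating the parity leaves a plain polynomial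
    term. *)
Definition signed (b : bool) (x : R) : R := if b then - x else x.

Lemma sum_sets (F : {set 'I_5} -> R) :
  \sum_A F A = foldr (fun s r => F (bset s) + r) 0 bseqs.
Proof.
(* The five membership bits of a set give a bijection with quintuples of booleans, and the sum over
   these is unrolled one bit at a time. *)
rewrite (reindex (fun t : bool * bool * bool * bool * bool =>
    bset [:: t.1.1.1.1; t.1.1.1.2; t.1.1.2; t.1.2; t.2])); last first.
  exists (fun A => (inord 0 \in A, inord 1 \in A, inord 2 \in A, inord 3 \in A, inord 4 \in A)).
    by move=> [[[[a b] c] d] e] _; rewrite !inE !inordK.
  move=> A _; apply/setP => i; rewrite inE /=.
  by case: i => -[|[|[|[|[|//]]]]] lt_i5 /=; congr (_ \in A); apply: val_inj; rewrite /= inordK.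
rewrite -(pair_bigA _ (fun (t : bool * bool * bool * bool) e =>
  F (bset [:: t.1.1.1; t.1.1.2; t.1.2; t.2; e])))/=.
rewrite -(pair_bigA _ (fun (t : bool * bool * bool) d =>
  \sum_e F (bset [:: t.1.1; t.1.2; t.2; d; e])))/=.
rewrite -(pair_bigA _ (fun (t : bool * bool) (c : bool) =>
  \sum_d \sum_e F (bset [:: t.1; t.2; c; d; e])))/=.
rewrite -(pair_bigA _ (fun a b : bool =>
  \sum_c \sum_d \sum_e F (bset [:: a; b; c; d; e])))/=.
rewrite !big_bool /=; ring.
Qed.

(** This and the next two definitions evaluate on bit vectors to the cardinality and to the
    exponents in [kappa] and [eps]. *)
Definition bsize (s : seq bool) : nat := sumn [seq nth false s k : nat | k : nat <- iota 0 5].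
Definition bkappa (s : seq bool) : nat :=
  (sumn [seq sumn [seq [&& nth false s k, ~~ nth false s l & l < k]%N : nat | l : nat <- iota 0 5]
       | k : nat <- iota 0 5] + (5 - bsize s)./2)%N.
Definition beps (i : nat) (s : seq bool) : nat :=
  sumn [seq nth false s l && (l < i)%N : nat | l : nat <- iota 0 5].

Lemma sum_iota (f : nat -> nat) : (\sum_(i < 5) f i)%N = sumn [seq f k | k : nat <- iota 0 5].
Proof. by rewrite sumnE big_map -(big_mkord xpredT f)/index_iota subn0. Qed.

Lemma card_bset s : #|bset s| = bsize s.
Proof.
rewrite -sum1_card big_mkcond -[RHS](sum_iota (fun k => nth false s k)).
by apply: eq_bigr => i _; rewrite inE; case: ifP.
Qed.

Lemma kappa_bset s : kappa R (bset s) = (-1) ^+ odd (bkappa s).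
Proof.
rewrite signr_odd /kappa wsignE -exprD; congr (_ ^+ (_ + _)%N).
  rewrite -(sum_iota (fun k =>
    sumn [seq [&& nth false s k, ~~ nth false s l & l < k]%N : nat | l : nat <- iota 0 5])).
  apply: eq_bigr => i _; rewrite -sum_iota.
  by apply: eq_bigr => j _; rewrite !inE.
by congr (_./2); rewrite cardsCs finset.setCK card_ord card_bset.
Qed.

Lemma eps_bset i s : eps R i (bset s) = (-1) ^+ odd (beps i s).
Proof.
rewrite signr_odd /eps wsignE inversions1l big_mkcond; congr (_ ^+ _).
transitivity (\sum_(l < 5) (nth false s l && (l < i)))%N; last first.
  exact: (sum_iota (fun l => nth false s l && (l < i)%N)).
by apply: eq_bigr => j _; rewrite inE; case: (nth _ _ _).
Qed.

Lemma setC_bset s : size s = 5%N -> ~: bset s = bset (map negb s).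
Proof.
by move=> s5; apply/setP => i; rewrite !inE (nth_map false) ?s5.
Qed.

Lemma toggle_bset i s : toggle i (bset s) = bset (set_nth false s i (~~ nth false s i)).
Proof.
apply/setP => j; rewrite in_toggle !inE nth_set_nth /= (inj_eq val_inj).
by case: eqP => [->|].
Qed.

Lemma size_bseqs s : s \in bseqs -> size s = 5%N.
Proof. by move=> s5; apply/eqP; move: s s5; apply/(@allP _ (fun s => size s == 5%N)). Qed.

(** The flag b selects dx_i or d/dx_i, and only the sets that contain i exactly when b holds
    contribute. In this fold form, simplification reduces the pairing to an explicit bilinear
    polynomial in the coordinates. *)
Lemma mukai_basis (b : bool) (i : 'I_5) phi psi :
  mukai (clifford (if b then (0, delta_mx 0 i) else (delta_mx 0 i, 0)) phi) psi =
  foldr (fun s r => (if nth false s i == b then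
     signed (odd (bkappa s) (+) odd (beps i s))
       (phi (bset (set_nth false s i (~~ b))) * psi (bset (map negb s))) else 0) + r) 0 bseqs.
Proof.
rewrite mukaiE sum_sets.
(* The induction runs over a sublist of [bseqs], remembered as such because complementing the bits
   requires length five. *)
have : {subset bseqs <= bseqs} by [].
elim: {1 3 4}bseqs => //= s t IH /[dup] sub /allP /= /andP[sb _].
rewrite IH => [|x xt]; last by apply: sub; rewrite inE xt orbT.
congr (_ + _); rewrite cliffordE (bigD1 i)//= big1 ?addr0 => [|j /negbTE ji]; last first.
  by rewrite /coef; case: (b); case: ifP; rewrite /= !mxE ?ji ?andbF ?mul0r.
rewrite setC_bset ?size_bseqs// kappa_bset eps_bset toggle_bset inE.
have -> : coef (if b then (0, delta_mx 0 i) else (delta_mx 0 i, 0)) i (nth false s i) =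
    (nth false s i == b)%:R :> R.
  by rewrite /coef; case: (b); case: (nth _ _ _); rewrite /= mxE ?eqxx.
case: eqP => [->|]; last by rewrite !mul0r mulr0.
by rewrite mul1r /signed; case: (odd _); case: (odd _) => /=; rewrite ?expr0 ?expr1; ring.
Qed.

(* A polynomial identity in the 16 coordinates of an even form. *)
Lemma ip_quad_quad phi : even_form phi -> ip (quad phi) (quad phi) = 0.
Proof.
move=> ev.
have odd0 s : odd (bsize s) -> phi (bset s) = 0 by move=> os; apply: ev; rewrite card_bset.
rewrite /ip; under eq_bigr => i _.
  rewrite !mxE (mukai_basis true) (mukai_basis false).
  over.
rewrite !big_ord_recl big_ord0 /=.
(* The sixteen coordinates on sets of odd size vanish; the identity in the remaining ones is left to
   [ring]. *)
rewrite ?(odd0 [:: false; false; false; false; true] isT)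
  ?(odd0 [:: false; false; false; true; false] isT)
  ?(odd0 [:: false; false; true; false; false] isT)
  ?(odd0 [:: false; false; true; true; true] isT)
  ?(odd0 [:: false; true; false; false; false] isT)
  ?(odd0 [:: false; true; false; true; true] isT)
  ?(odd0 [:: false; true; true; false; true] isT)
  ?(odd0 [:: false; true; true; true; false] isT)
  ?(odd0 [:: true; false; false; false; false] isT)
  ?(odd0 [:: true; false; false; true; true] isT)
  ?(odd0 [:: true; false; true; false; true] isT)
  ?(odd0 [:: true; false; true; true; false] isT)
  ?(odd0 [:: true; true; false; false; true] isT)
  ?(odd0 [:: true; true; false; true; false] isT)
  ?(odd0 [:: true; true; true; false; false] isT)
  ?(odd0 [:: true; true; true; true; true] isT).
ring.
Qed.

(** The polarization of [quad], symmetric by [clifford_adj] and [mukaiC]; along a pencil it plays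
    the part of h. *)
Definition bquad phi psi : gvec R 5 :=
  (\row_i (2 * mukai (clifford (0, delta_mx 0 i) phi) psi),
   \row_i (2 * mukai (clifford (delta_mx 0 i, 0) phi) psi)).

Lemma bquadP phi psi v : ip (bquad phi psi) v = mukai (clifford v phi) psi.
Proof.
have -> : mukai (clifford v phi) psi =
    mukai (Defs.contract v.1 phi) psi + mukai (wedge (oneform v.2) phi) psi.
  by rewrite -mukaiDl.
rewrite contractE oneformE wedge_suml !mukai_sum /ip mulr_sumr -big_split.
apply: eq_bigr => i _; rewrite !mxE /clifford/= oneform0 wedge0 addr0.
by rewrite Defs.contract0 add0r /=; field.
Qed.

Lemma quad_pencil phi psi (z : R) :
  quad (phi + z *: psi) = vz z (quad phi) (bquad phi psi) (quad psi).
Proof.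
apply: ip_ext => c; rewrite /vz !(ipDl, ipZl) !quadP bquadP.
rewrite !(cliffordDr, cliffordZr) (mukaiDl (clifford c phi)) mukaiZl !mukaiDr !mukaiZr.
by rewrite (clifford_adj c psi phi) (mukaiC psi); ring.
Qed.

Lemma null_pencil (a b c : gvec R 5) :
  (forall z : R, ip (vz z a b c) (vz z a b c) = 0) ->
  [/\ ip a a = 0, ip a b = 0, ip c c = 0, ip b c = 0 & 2 * ip b b + ip a c = 0].
Proof.
have E z : ip (vz z a b c) (vz z a b c) = ip a a + 4 * z * ip a b +
    z ^+ 2 * (4 * ip b b + 2 * ip a c) + 4 * z ^+ 3 * ip b c + z ^+ 4 * ip c c.
  by rewrite /vz !(ipDl, ipDr, ipZl, ipZr) (ipC b a) (ipC c a) (ipC c b); ring.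
(* A polynomial of degree four that vanishes at five points has zero coefficients. *)
move=> H; have := H 0; have := H 1; have := H (-1); have := H 2; have := H (-2).
rewrite !E => *; split; lra.
Qed.

Lemma even_formD phi psi (z : R) : even_form phi -> even_form psi -> even_form (phi + z *: psi).
Proof. by move=> h k S oS; rewrite !ffunE h// k// scaler0 addr0. Qed.

(** Basis forms isolate single coefficients. Since the dimension is odd, the complement of an odd
    set is even, so even test forms see every odd coefficient. *)
Lemma mukai_even_nondeg phi :
  odd_form phi -> (forall psi, even_form psi -> mukai phi psi = 0) -> phi = 0.
Proof.
move=> oph H; apply/ffunP => S; rewrite [RHS]ffunE.
have [oS|/oph//] := boolP (odd #|S|).
have /H : even_form (deltaform R (~: S)).
  move=> T; rewrite ffunE; case: eqP => // -> ; rewrite cardsCs finset.setCK card_ord.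
  by rewrite oddB ?oS// (leq_trans (max_card _))// card_ord.
by move/eqP; rewrite mukai_delta mulf_eq0 (negbTE (kappa_neq0 _ _)) => /eqP.
Qed.

(** The polarization of [ip_quad_quad]: paired with an even psi, the left side is (Q phi,
    [bquad phi psi]), up to a factor the linear coefficient of the norm of Q(phi + z psi). *)
Lemma clifford_quad phi : even_form phi -> clifford (quad phi) phi = 0.
Proof.
move=> ev; apply: mukai_even_nondeg; first exact: clifford_parity.
move=> psi evp; rewrite -bquadP ipC.
have [|_ -> //] := @null_pencil (quad phi) (bquad phi psi) (quad psi).
by move=> z; rewrite -quad_pencil ip_quad_quad//; exact: even_formD.
Qed.

(** Self-adjointness moves one factor c across the pairing, and c v c = 2 (c, v) c - (c, c) v. *)
Lemma quad_clifford c phi :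
  quad (clifford c phi) = (2 * ip c (quad phi)) *: c - ip c c *: quad phi.
Proof.
apply: ip_ext => v; rewrite ipBl !ipZl !quadP -clifford_adj.
have /eqP := clifford_rel c v (clifford c phi).
rewrite clifford_sq cliffordZr eq_sym -subr_eq => /eqP <-.
rewrite -scaleNr mukaiDl !mukaiZl (ipC c (quad _)) quadP; ring.
Qed.

Lemma quad0 : quad (0 : extform R 5) = 0.
Proof.
by apply: ip_ext => v; rewrite quadP clifford0r mukai0l ip0l.
Qed.

(** A nonzero c is null, because c.c.phi = (c, c) phi. For b with (c, b) nonzero, phi = c.psi with
    psi a multiple of b.phi, so [quad_clifford] gives Q(phi) = 2 (c, Q(psi)) c. *)
Lemma annihilator c phi : clifford c phi = 0 -> quad phi != 0 ->
  exists a : R, c = a *: quad phi.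
Proof.
move=> cphi q0; have [->|c0] := eqVneq c 0; first by exists 0; rewrite scale0r.
have [b cb] : exists b, ip c b != 0.
  apply: contrapT => H; case/eqP: c0; apply: ip_nondeg => b.
  by apply/eqP; apply: contra_notT H => ?; exists b.
have cc : ip c c = 0.
  have := clifford_sq c phi; rewrite cphi clifford0r => /eqP.
  rewrite eq_sym scaler_eq0 => /orP[/eqP//|/eqP phi0].
  by rewrite phi0 quad0 eqxx in q0.
pose psi := (2 * ip c b)^-1 *: clifford b phi.
have phiE : phi = clifford c psi.
  have := clifford_rel c b phi; rewrite cphi clifford0r addr0 /psi cliffordZr => ->.
  by rewrite scalerA mulVf ?scale1r// mulf_neq0// pnatr_eq0.
have qE : quad phi = (2 * ip c (quad psi)) *: c.
  by rewrite phiE quad_clifford cc scale0r subr0.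
exists (2 * ip c (quad psi))^-1; rewrite qE scalerA mulVf ?scale1r//.
by apply: contraNneq q0 => E; rewrite qE E scale0r.
Qed.

End Five.

(** * Leibniz rules *)

Local Open Scope classical_set_scope.
Local Open Scope ring_scope.

Section Leibniz.
Variables (R : realType) (m : nat).
Implicit Types (x e : 'rV[R]_m) (f g : 'rV[R]_m -> R).

(** In coordinates the inner product, Clifford multiplication and the Mukai pairing are all sums of
    this shape; their product rules come from this lemma and the next. *)
Lemma differentiable_sumM (I : Type) (r : seq I) (c : I -> R) (f g : I -> 'rV[R]_m -> R) x :
  (forall i, differentiable (f i) x) -> (forall i, differentiable (g i) x) ->
  differentiable (fun y => \sum_(i <- r) c i * (f i y * g i y)) x.
Proof.
move=> df dg; elim: r => [|i r IH].
  under eq_fun do rewrite big_nil; exact: differentiable_cst.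
under eq_fun do rewrite big_cons.
apply: differentiableD => //.
apply: (@differentiableM _ _ (cst (c i))); first exact: differentiable_cst.
exact: differentiableM.
Qed.

Lemma derive_sumM (I : Type) (r : seq I) (c : I -> R) (f g : I -> 'rV[R]_m -> R) e x :
  (forall i, differentiable (f i) x) -> (forall i, differentiable (g i) x) ->
  'D_e (fun y => \sum_(i <- r) c i * (f i y * g i y)) x =
  \sum_(i <- r) c i * ('D_e (f i) x * g i x + f i x * 'D_e (g i) x).
Proof.
move=> df dg; elim: r => [|i r IH].
  rewrite big_nil; under eq_fun do rewrite big_nil; exact: derive_cst.
rewrite big_cons; under eq_fun do rewrite big_cons.
rewrite (@deriveD _ _ _ (fun y => c i * (f i y * g i y))); last 2 first.
- apply/diff_derivable/(@differentiableM _ _ (cst (c i))).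
    exact: differentiable_cst.
  exact: differentiableM.
- exact/diff_derivable/differentiable_sumM.
rewrite IH; congr (_ + _).
rewrite (@deriveMl _ _ (fun y => f i y * g i y) (c i)); last exact/diff_derivable/differentiableM.
rewrite deriveM; [|exact/diff_derivable..].
by rewrite /GRing.scale/=; ring.
Qed.

End Leibniz.

(** * Directional derivatives of forms and of generalized vectors *)

Section Fields.
Variables (R : realType) (m n : nat).
Implicit Types (x e : 'rV[R]_m) (f g : 'rV[R]_m -> R).
Implicit Types (a b : 'rV[R]_m -> gvec R n) (F G : 'rV[R]_m -> extform R n).

(** The number m of parameters is kept apart from n: on the cylinder, forms on a five-manifold
    depend on six coordinates. *)
Definition diff_form F x := forall S, differentiable (fun y => F y S : R) x.
Definition diff_gen a x := forall k,
  differentiable (fun y => (a y).1 0 k) x /\ differentiable (fun y => (a y).2 0 k) x.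

Definition Dform e F x : extform R n := [ffun S => 'D_e (fun y => F y S : R) x].
Definition Dgen e a x : gvec R n :=
  (\row_k 'D_e (fun y => (a y).1 0 k) x, \row_k 'D_e (fun y => (a y).2 0 k) x).

Lemma Dform_near e F G x : (\forall y \near x, F y = G y) -> Dform e F x = Dform e G x.
Proof.
by move=> FG; apply/ffunP => S; rewrite !ffunE; apply: near_eq_derive;
  apply: filterS FG => y ->.
Qed.

Lemma Dgen_near e a b x : (\forall y \near x, a y = b y) -> Dgen e a x = Dgen e b x.
Proof.
by move=> FG; congr pair; apply/rowP => k; rewrite !mxE; apply: near_eq_derive;
  apply: filterS FG => y ->.
Qed.

Lemma Dform_cst e (phi : extform R n) x : Dform e (fun=> phi) x = 0.
Proof. by apply/ffunP => S; rewrite !ffunE; exact: derive_cst. Qed.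

Lemma diff_gen_cst (v : gvec R n) x : diff_gen (fun=> v) x.
Proof. by move=> k; split; exact: differentiable_cst. Qed.

Lemma Dgen_cst e (v : gvec R n) x : Dgen e (fun=> v) x = 0.
Proof. by congr pair; apply/rowP => k; rewrite !mxE; exact: derive_cst. Qed.

Lemma diff_gen_coef a x i (s : bool) : diff_gen a x -> differentiable (fun y => coef (a y) i s) x.
Proof. by move=> /(_ i)[? ?]; case: s. Qed.

Lemma Dgen_coef e a x i (s : bool) : 'D_e (fun y => coef (a y) i s) x = coef (Dgen e a x) i s.
Proof. by case: s; rewrite /coef mxE. Qed.

Lemma ipE (v w : gvec R n) :
  ip v w = \sum_(p : 'I_n * bool) 2^-1 * (coef v p.1 p.2 * coef w p.1 (~~ p.2)).
Proof.
rewrite -(pair_bigA _ (fun i s => 2^-1 * (coef v i s * coef w i (~~ s))))/=.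
rewrite /ip mulr_sumr; apply: eq_bigr => i _; rewrite big_bool /coef /=; ring.
Qed.

Lemma diff_ip a b x : diff_gen a x -> diff_gen b x ->
  differentiable (fun y => ip (a y) (b y)) x.
Proof.
move=> da db; under eq_fun do rewrite ipE.
by apply: differentiable_sumM => p; exact: diff_gen_coef.
Qed.

Lemma derive_ip e a b x : diff_gen a x -> diff_gen b x ->
  'D_e (fun y => ip (a y) (b y)) x = ip (Dgen e a x) (b x) + ip (a x) (Dgen e b x).
Proof.
move=> da db; under eq_fun do rewrite ipE.
rewrite derive_sumM => [|p|p]; [|exact: diff_gen_coef..].
rewrite !ipE -big_split; apply: eq_bigr => p _ /=.
by rewrite !Dgen_coef; ring.
Qed.

Lemma diff_genD a b x : diff_gen a x -> diff_gen b x -> diff_gen (fun y => a y + b y) x.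
Proof.
move=> da db k; have [? ?] := da k; have [? ?] := db k.
by split; under eq_fun do rewrite /= mxE; exact: differentiableD.
Qed.

Lemma DgenD e a b x : diff_gen a x -> diff_gen b x ->
  Dgen e (fun y => a y + b y) x = Dgen e a x + Dgen e b x.
Proof.
move=> da db; congr pair; apply/rowP => k; rewrite !mxE; have [? ?] := da k; have [? ?] := db k.
  by under eq_fun do rewrite /= mxE; rewrite deriveD//; exact: diff_derivable.
by under eq_fun do rewrite /= mxE; rewrite deriveD//; exact: diff_derivable.
Qed.

Lemma diff_genZ f a x : differentiable f x -> diff_gen a x -> diff_gen (fun y => f y *: a y) x.
Proof.
move=> df da k; have [? ?] := da k.
by split; under eq_fun do rewrite /= mxE; exact: differentiableM.
Qed.

Lemma DgenZ e f a x : differentiable f x -> diff_gen a x ->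
  Dgen e (fun y => f y *: a y) x = 'D_e f x *: a x + f x *: Dgen e a x.
Proof.
move=> df da; congr pair; apply/rowP => k; rewrite !mxE; have [? ?] := da k.
  under eq_fun do rewrite /= mxE; rewrite deriveM; [|exact: diff_derivable..].
  by rewrite addrC; congr (_ + _); exact: mulrC.
under eq_fun do rewrite /= mxE; rewrite deriveM; [|exact: diff_derivable..].
by rewrite addrC; congr (_ + _); exact: mulrC.
Qed.

Lemma diff_clifford a F x : diff_gen a x -> diff_form F x ->
  diff_form (fun y => clifford (a y) (F y)) x.
Proof.
move=> da dF S; under eq_fun do rewrite cliffordE.
under eq_fun do under eq_bigr do rewrite mulrCA.
apply: differentiable_sumM => i //; exact: diff_gen_coef.
Qed.

Lemma Dform_clifford e a F x : diff_gen a x -> diff_form F x ->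
  Dform e (fun y => clifford (a y) (F y)) x =
  clifford (Dgen e a x) (F x) + clifford (a x) (Dform e F x).
Proof.
move=> da dF; apply/ffunP => S; rewrite 2!ffunE !cliffordE.
under eq_fun do rewrite cliffordE.
under eq_fun do under eq_bigr do rewrite mulrCA.
rewrite derive_sumM => [|i|i]; [|exact: diff_gen_coef|exact: dF].
rewrite -big_split; apply: eq_bigr => i _ /=.
by rewrite Dgen_coef ffunE; ring.
Qed.

Lemma diff_mukai F G x : diff_form F x -> diff_form G x ->
  differentiable (fun y => mukai (F y) (G y)) x.
Proof.
by move=> dF dG; under eq_fun do rewrite mukaiE; exact: differentiable_sumM.
Qed.

Lemma derive_mukai e F G x : diff_form F x -> diff_form G x ->
  'D_e (fun y => mukai (F y) (G y)) x = mukai (Dform e F x) (G x) + mukai (F x) (Dform e G x).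
Proof.
move=> dF dG; under eq_fun do rewrite mukaiE.
rewrite derive_sumM// !mukaiE -big_split; apply: eq_bigr => S _ /=.
by rewrite !ffunE; ring.
Qed.

End Fields.

(** With d written through Clifford multiplication by the dx_j, the Clifford relations suffice to
    commute it with v and u. *)
Lemma ext_dE (R : realType) (n : nat) (phi : 'rV[R]_n -> extform R n) x :
  ext_d phi x = \sum_j clifford (0, delta_mx 0 j) (Dform (delta_mx 0 j) phi x).
Proof.
apply/ffunP => S; rewrite sum_ffunE ffunE big_mkcond; apply: eq_bigr => j _.
rewrite cliffordE (bigD1 j)//= big1 ?addr0 => [|i /negbTE ij]; last first.
  by rewrite /coef; case: ifP; rewrite /= !mxE ?ij ?andbF ?mul0r.
rewrite ffunE /coef /= !mxE !eqxx; case: ifPn => jS; last by rewrite mul0r.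
have -> : S :\ j = toggle j S by rewrite /toggle jS.
by rewrite -[wsign _ _ _]/(eps R j _) eps_toggle ltnn !mul1r.
Qed.

(** * The Courant bracket through coordinate derivatives *)

Section Courant.
Variables (R : realType) (n : nat).
Implicit Types (a b V W : 'rV[R]_n -> gvec R n) (x : 'rV[R]_n).
Local Notation e j := (delta_mx 0 j : 'rV[R]_n).

(** Coordinate differentiation acts as a flat connection: the transport terms are D_a b - D_b a, and
    what is left of the Lie derivatives merges with the gradient into inner products. *)
Lemma courantE a b x : diff_gen a x -> diff_gen b x ->
  courant a b x = \sum_j ((a x).1 0 j *: Dgen (e j) b x - (b x).1 0 j *: Dgen (e j) a x)
    + (0, \row_k (ip (Dgen (e k) a x) (b x) - ip (a x) (Dgen (e k) b x))).
Proof.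
move=> da db.
have fstS (F : 'I_n -> gvec R n) : (\sum_j F j).1 = \sum_j (F j).1.
  by elim/big_rec2: _ => // i y1 y2 _ <-.
have sndS (F : 'I_n -> gvec R n) : (\sum_j F j).2 = \sum_j (F j).2.
  by elim/big_rec2: _ => // i y1 y2 _ <-.
congr pair; apply/rowP => k.
  rewrite fstS !mxE addr0 summxE; apply: eq_bigr => j _.
  by rewrite !mxE.
rewrite sndS !mxE summxE.
have -> : partial k (fun y => \sum_i ((a y).1 0 i * (b y).2 0 i - (b y).1 0 i * (a y).2 0 i)) x =
  \sum_i ((Dgen (e k) a x).1 0 i * (b x).2 0 i + (a x).1 0 i * (Dgen (e k) b x).2 0 i -
     (Dgen (e k) b x).1 0 i * (a x).2 0 i - (b x).1 0 i * (Dgen (e k) a x).2 0 i).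
  have -> : (fun y => \sum_i ((a y).1 0 i * (b y).2 0 i - (b y).1 0 i * (a y).2 0 i)) =
     (fun y => \sum_i 1 * ((a y).1 0 i * (b y).2 0 i)) +
     (fun y => \sum_i (- 1) * ((b y).1 0 i * (a y).2 0 i)).
    apply/funext => y; rewrite [RHS]/GRing.add /= -big_split; apply: eq_bigr => i _ /=; ring.
  have d1 i := (da i).1; have d2 i := (da i).2; have d3 i := (db i).1; have d4 i := (db i).2.
  rewrite /partial deriveD; [|exact/diff_derivable/differentiable_sumM..].
  rewrite !derive_sumM// -big_split; apply: eq_bigr => i _ /=; rewrite !mxE; ring.
rewrite /ip -mulrBr -!sumrB !mulr_sumr -sumrB -big_split /=.
by apply: eq_bigr => j _; rewrite !mxE /partial; field.
Qed.

End Courant.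

(** * The Courant bracket on spans, and on a cylinder *)

Section CourantSpan.
Variables (R : realType) (n : nat).
Implicit Types (a b V W : 'rV[R]_n -> gvec R n) (x : 'rV[R]_n) (f g : 'rV[R]_n -> R).
Local Notation e j := (delta_mx 0 j : 'rV[R]_n).

(** The bracket is not bilinear over functions, but its anomalous terms carry an inner product of V
    and W as a factor or are multiples of V and W. On an isotropic span, integrability thus reduces
    to the single bracket of V and W. *)
Lemma courant_comb a b V W f g f' g' x :
  diff_gen a x -> diff_gen b x -> diff_gen V x -> diff_gen W x ->
  differentiable f x -> differentiable g x -> differentiable f' x -> differentiable g' x ->
  (\forall y \near x, a y = f y *: V y + g y *: W y) ->
  (\forall y \near x, b y = f' y *: V y + g' y *: W y) ->
  ip (V x) (V x) = 0 -> ip (V x) (W x) = 0 -> ip (W x) (W x) = 0 ->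
  courant a b x \in <<[:: V x; W x; courant V W x]>>%VS.
Proof.
move=> da db dV dW df dg df' dg' aE bE VV VW WW.
have Da k : Dgen (e k) a x = 'D_(e k) f x *: V x + f x *: Dgen (e k) V x +
    ('D_(e k) g x *: W x + g x *: Dgen (e k) W x).
  rewrite (Dgen_near _ aE) DgenD ?DgenZ //; exact: diff_genZ.
have Db k : Dgen (e k) b x = 'D_(e k) f' x *: V x + f' x *: Dgen (e k) V x +
    ('D_(e k) g' x *: W x + g' x *: Dgen (e k) W x).
  rewrite (Dgen_near _ bE) DgenD ?DgenZ //; exact: diff_genZ.
(* The coefficients of V and W are the derivatives of the coefficients of b along a minus those of
   the coefficients of a along b. *)
have -> : courant a b x =
    (\sum_j ((a x).1 0 j * 'D_(e j) f' x - (b x).1 0 j * 'D_(e j) f x)) *: V x +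
    ((\sum_j ((a x).1 0 j * 'D_(e j) g' x - (b x).1 0 j * 'D_(e j) g x)) *: W x +
    (f x * g' x - g x * f' x) *: courant V W x).
  apply: ip_ext => c; rewrite !courantE// !(ipDl, ipZl) !ip_suml !ip_oneform.
  rewrite mulrDr !mulr_sumr !mulr_suml -!big_split /=; apply: eq_bigr => k _.
  rewrite !ipBl !ipZl Da Db !(ipDl, ipZl) (nbhs_singleton aE) (nbhs_singleton bE).
  rewrite !(ipDr, ipZr) !(ipDl, ipZl) !mxE VV (ipC (W x) (V x)) VW WW.
  rewrite (ipC (V x) (Dgen _ V x)) (ipC (W x) (Dgen _ V x)).
  rewrite (ipC (V x) (Dgen _ W x)) (ipC (W x) (Dgen _ W x)).
  ring.
rewrite 2!span_cons span_seq1.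
by apply: memv_add; [|apply: memv_add]; rewrite ?memvZ ?memv_line.
Qed.

(** Pointwise membership yields differentiable coefficients: that of W is the component t of a, and
    that of V follows by pairing with a fixed c not orthogonal to V x, hence not to V nearby. *)
Lemma span_coefs a V W (t : 'I_n) x (U : set 'rV[R]_n) : open U -> U x ->
  (forall y, U y -> a y \in <<[:: V y; W y]>>%VS) ->
  (forall y, U y -> (V y).1 0 t = 0) -> (forall y, U y -> (W y).1 0 t = 1) ->
  V x != 0 -> diff_gen a x -> diff_gen V x -> diff_gen W x ->
  exists f g : 'rV[R]_n -> R, [/\ differentiable f x, differentiable g x &
     \forall y \near x, a y = f y *: V y + g y *: W y].
Proof.
move=> oU Ux aU V0 W1 Vx da dV dW.
have [c Vc] : exists c, ip (V x) c != 0.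
  apply: contrapT => H; case/eqP: Vx; apply: ip_nondeg => c.
  by apply/eqP; apply: contra_notT H => ?; exists c.
have dg : differentiable (fun y => (a y).1 0 t) x by have [] := da t.
have dVc : differentiable (fun y => ip (V y) c) x by apply: diff_ip => //; exact: diff_gen_cst.
exists (fun y => (ip (a y) c - (a y).1 0 t * ip (W y) c) / ip (V y) c), (fun y => (a y).1 0 t).
split => //.
  apply: differentiableM; last exact: differentiableV.
  apply: differentiableB; first by apply: diff_ip => //; exact: diff_gen_cst.
  by apply: differentiableM => //; apply: diff_ip => //; exact: diff_gen_cst.
have nV : \forall y \near x, ip (V y) c != 0.
  have := differentiable_continuous dVc; move/(_ [set z | z != 0]); apply.
  exact: open_nbhs_nbhs (conj (@open_neq R 0) Vc).
near=> y.
have Uy : U y by near: y; exact: open_nbhs_nbhs.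
have Vcy : ip (V y) c != 0 by near: y.
have := aU y Uy; rewrite span_cons span_seq1.
case/memv_addP => _ /vlineP[al ->] [_ /vlineP[be ->] ayE].
have beE : (a y).1 0 t = be by rewrite ayE !mxE V0// W1// mulr0 add0r mulr1.
by rewrite beE ayE ipDl !ipZl addrK mulfK.
Unshelve. all: by end_near.
Qed.

End CourantSpan.

(** * Generalized vectors on the cylinder, split into time and space *)

Section Cylinder.
Variables (R : realType) (n : nat).
Implicit Types (a b c : gvec R n) (d : gvec R (1 + n)).
Implicit Types (v u : 'rV[R]_(1 + n) -> gvec R n) (y : 'rV[R]_(1 + n)).

Definition time_idx : 'I_(1 + n) := lshift n ord0.
Definition space_idx (j : 'I_n) : 'I_(1 + n) := rshift 1 j.

Lemma big_time (F : 'I_(1 + n) -> R) : \sum_i F i = F time_idx + \sum_j F (space_idx j).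
Proof. by rewrite big_split_ord big_ord1. Qed.

(** The adjoint of [lift_gvec] for the two inner products. *)
Definition proj_gvec d : gvec R n := (rsubmx d.1, rsubmx d.2).

Lemma lift1t a : (lift_gvec a).1 0 time_idx = 0.
Proof. by rewrite /lift_gvec /= row_mxEl mxE. Qed.
Lemma lift2t a : (lift_gvec a).2 0 time_idx = 0.
Proof. by rewrite /lift_gvec /= row_mxEl mxE. Qed.
Lemma lift1s a j : (lift_gvec a).1 0 (space_idx j) = a.1 0 j.
Proof. by rewrite /lift_gvec /= row_mxEr. Qed.
Lemma lift2s a j : (lift_gvec a).2 0 (space_idx j) = a.2 0 j.
Proof. by rewrite /lift_gvec /= row_mxEr. Qed.

Lemma ip_liftl a d : ip (lift_gvec a) d = ip a (proj_gvec d).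
Proof.
rewrite /ip big_time lift1t lift2t mul0r mulr0 !add0r; congr (_ * _).
by apply: eq_bigr => j _; rewrite lift1s lift2s !mxE.
Qed.

Lemma proj_lift a : proj_gvec (lift_gvec a) = a.
Proof. by case: a => a1 a2; rewrite /proj_gvec /lift_gvec /= !row_mxKr. Qed.

Lemma proj_gvec0 : proj_gvec 0 = 0.
Proof. by congr pair; apply/rowP => i; rewrite !mxE. Qed.

Lemma ip_ddt d : ip (ddt R n) d = 2^-1 * d.2 0 time_idx.
Proof.
rewrite /ip big_time big1 => [|j _]; first by rewrite /= row_mxEl !mxE mul1r mulr0 !addr0.
by rewrite /= row_mxEr !mxE mul0r mulr0 addr0.
Qed.

Lemma ip_dt d : ip (dt R n) d = 2^-1 * d.1 0 time_idx.
Proof.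
rewrite /ip big_time big1 => [|j _]; first by rewrite /= row_mxEl !mxE mulr1 mul0r !addr0 add0r.
by rewrite /= row_mxEr !mxE mul0r mulr0 addr0.
Qed.

Definition wvec a : gvec R (1 + n) := ddt R n - 2 *: dt R n - lift_gvec a.

Lemma wvec_fst a k : (wvec a).1 0 k =
  (ddt R n).1 0 k - 2 * (dt R n).1 0 k - (lift_gvec a).1 0 k.
Proof. by rewrite /wvec !mxE. Qed.

Lemma wvec_snd a k : (wvec a).2 0 k =
  (ddt R n).2 0 k - 2 * (dt R n).2 0 k - (lift_gvec a).2 0 k.
Proof. by rewrite /wvec !mxE. Qed.

Lemma wvec1t a : (wvec a).1 0 time_idx = 1.
Proof. by rewrite wvec_fst lift1t /= row_mxEl !mxE mulr0 !subr0. Qed.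

Lemma wvec1s a j : (wvec a).1 0 (space_idx j) = - a.1 0 j.
Proof. by rewrite wvec_fst lift1s /= row_mxEr !mxE mulr0 !subr0 sub0r. Qed.

Lemma ip_lift_wvec a b : ip (lift_gvec a) (wvec b) = - ip a b.
Proof.
rewrite /wvec !ipBr ipZr ![ip (lift_gvec a) _]ipC ip_ddt ip_dt lift1t lift2t ip_liftl proj_lift.
by rewrite (ipC b); ring.
Qed.

(** The norm of d/dt - 2 dt is -2, so w is null exactly when u has norm 2. *)
Lemma ip_wvec a : ip (wvec a) (wvec a) = ip a a - 2.
Proof.
rewrite {1}/wvec !ipBl ip_lift_wvec ipZl ip_ddt ip_dt wvec1t.
by rewrite wvec_snd lift2t /= row_mxEl !mxE; field.
Qed.

Lemma diff_lift v y : diff_gen v y -> diff_gen (fun y => lift_gvec (v y)) y.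
Proof.
move=> dv k; case: (split_ordP k) => j ->.
  rewrite (ord1 j); split; [under eq_fun do rewrite lift1t|under eq_fun do rewrite lift2t];
  exact: differentiable_cst.
have [? ?] := dv j.
by split; [under eq_fun do rewrite lift1s|under eq_fun do rewrite lift2s].
Qed.

Lemma Dgen_lift e v y : Dgen e (fun y => lift_gvec (v y)) y = lift_gvec (Dgen e v y).
Proof.
congr pair; apply/rowP => k; case: (split_ordP k) => j ->;
  rewrite ?(ord1 j) mxE ?row_mxEl ?row_mxEr !mxE.
- by under eq_fun do rewrite lift1t; exact: derive_cst.
- by under eq_fun do rewrite lift1s.
- by under eq_fun do rewrite lift2t; exact: derive_cst.
- by under eq_fun do rewrite lift2s.
Qed.

Lemma wvecE u y : wvec (u y) = (-1) *: lift_gvec (u y) + (ddt R n - 2 *: dt R n).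
Proof. by rewrite scaleN1r addrC. Qed.

Lemma diff_wvec u y : diff_gen u y -> diff_gen (fun y => wvec (u y)) y.
Proof.
move=> du; under eq_fun do rewrite wvecE.
apply: diff_genD; last exact: diff_gen_cst.
by apply: diff_genZ; [exact: differentiable_cst|exact: diff_lift].
Qed.

Lemma Dgen_wvec e u y : diff_gen u y ->
  Dgen e (fun y => wvec (u y)) y = - lift_gvec (Dgen e u y).
Proof.
move=> du; under eq_fun do rewrite wvecE.
have dl := diff_lift du.
have dc : differentiable (fun=> -1 : R) y by exact: differentiable_cst.
rewrite DgenD; [|exact: diff_genZ|exact: diff_gen_cst].
by rewrite Dgen_cst addr0 DgenZ// derive_cst scale0r add0r Dgen_lift scaleN1r.
Qed.

Local Notation e j := (delta_mx 0 j : 'rV[R]_(1 + n)).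

(** In [courantE] the time index contributes the dt component and, since w has time component 1, the
    term v_t. The first and last summands under [lift_gvec] form the bracket of v and u on a time
    slice. *)
Lemma courant_lift_wvec v u y : diff_gen v y -> diff_gen u y ->
  courant (fun y => lift_gvec (v y)) (fun y => wvec (u y)) y =
  (ip (v y) (Dgen (e time_idx) u y) - ip (Dgen (e time_idx) v y) (u y)) *: dt R n -
  lift_gvec (\sum_j ((v y).1 0 j *: Dgen (e (space_idx j)) u y -
                     (u y).1 0 j *: Dgen (e (space_idx j)) v y)
    + Dgen (e time_idx) v y
    + (0, \row_j (ip (Dgen (e (space_idx j)) v y) (u y) - ip (v y) (Dgen (e (space_idx j)) u y)))).
Proof.
move=> dv du; have dl := diff_lift dv; have dw := diff_wvec du.
rewrite courantE//; apply: ip_ext => d.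
rewrite [LHS]ipDl ip_suml [X in _ + X]ip_oneform !big_time.
rewrite [RHS]ipBl [in RHS]ipZl ip_dt [in RHS]ip_liftl [in RHS]ipDl [X in _ - (X + _)]ipDl.
rewrite [X in _ - (X + _ + _)]ip_suml [X in _ - (_ + X)]ip_oneform.
rewrite !Dgen_lift !Dgen_wvec// lift1t wvec1t scale0r scale1r sub0r ipNl ip_liftl.
rewrite ip_lift_wvec ipNr ip_liftl proj_lift.
have E1 : \sum_j ip ((lift_gvec (v y)).1 0 (space_idx j) *:
         Dgen (e (space_idx j)) (fun y0 => wvec (u y0)) y -
       (wvec (u y)).1 0 (space_idx j) *: Dgen (e (space_idx j)) (fun y0 => lift_gvec (v y0)) y) d =
    - \sum_j ip ((v y).1 0 j *: Dgen (e (space_idx j)) u y -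
          (u y).1 0 j *: Dgen (e (space_idx j)) v y) (proj_gvec d).
  rewrite -sumrN; apply: eq_bigr => j _.
  rewrite Dgen_wvec// Dgen_lift lift1s wvec1s !ipBl !ipZl ipNl !ip_liftl; ring.
have E2 : \sum_j 2^-1 * (d.1 0 (space_idx j) *
       (ip (Dgen (e (space_idx j)) (fun y0 => lift_gvec (v y0)) y) (wvec (u y)) -
        ip (lift_gvec (v y)) (Dgen (e (space_idx j)) (fun y0 => wvec (u y0)) y))) =
    - \sum_j 2^-1 * ((proj_gvec d).1 0 j *
       (ip (Dgen (e (space_idx j)) v y) (u y) - ip (v y) (Dgen (e (space_idx j)) u y))).
  rewrite -sumrN; apply: eq_bigr => j _.
  by rewrite Dgen_wvec// Dgen_lift ip_lift_wvec ipNr ip_liftl proj_lift mxE; ring.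
rewrite E1 E2; ring.
Qed.

End Cylinder.

(** * The flow in a chart *)

(** The pointwise algebra behind ([v, u] + v_t).s = 0: [dv], [du], [ds] stand for space derivatives,
    [v0] and [s0] for time derivatives. The one-form is that of the bracket when (u, v) = 0 has been
    differentiated. *)
Lemma bracket_kills (R : realType) (n : nat) (v u v0 : gvec R n) (s s0 : extform R n)
    (dv du : 'I_n -> gvec R n) (ds : 'I_n -> extform R n) :
  (forall j, clifford (dv j) s + clifford v (ds j) = 0) ->
  clifford v0 s + clifford v s0 = 0 ->
  clifford v s = 0 ->
  \sum_j clifford (0, delta_mx 0 j) (ds j) = 0 ->
  s0 = \sum_j clifford (0, delta_mx 0 j) (clifford (du j) s + clifford u (ds j)) ->
  clifford (\sum_j (v.1 0 j *: du j - u.1 0 j *: dv j) + v0 +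
    (0, \row_j (- (2 * ip v (du j))))) s = 0.
Proof.
move=> Hj H0 vs closed flow.
pose e j : gvec R n := (0, delta_mx 0 j).
have ipe j w : 2 * ip (e j) w = w.1 0 j.
  rewrite /ip mulrA mulfV ?pnatr_eq0// mul1r (bigD1 j)//= big1 ?addr0 => [|i /negbTE ij].
    by rewrite !mxE !eqxx mul0r mulr1 add0r.
  by rewrite !mxE ij mul0r mulr0 addr0.
have -> : (0, \row_j (- (2 * ip v (du j)))) = \sum_j (- (2 * ip v (du j))) *: e j :> gvec R n.
  apply: ip_ext => c; rewrite ip_oneform ip_suml; apply: eq_bigr => j _.
  by rewrite ipZl -ipe; field.
rewrite !cliffordDl !clifford_suml.
have -> : clifford v0 s = - clifford v s0 by apply/eqP; rewrite -addr_eq0 H0.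
have -> : clifford v s0 = \sum_j clifford v (clifford (e j) (clifford (du j) s)) +
    \sum_j clifford v (clifford (e j) (clifford u (ds j))).
  by rewrite flow clifford_sumr -big_split; apply: eq_bigr => j _ /=; rewrite !cliffordDr.
(* Commuting [e j] past u produces the component of u along d/dx_j; the remainder is v.u applied to
   the sum of the e_j.ds_j, which is zero by closedness. *)
have -> : \sum_j clifford v (clifford (e j) (clifford u (ds j))) =
    \sum_j u.1 0 j *: clifford v (ds j) .
  have E j : clifford v (clifford (e j) (clifford u (ds j))) =
      u.1 0 j *: clifford v (ds j) - clifford v (clifford u (clifford (e j) (ds j))).
    rewrite -cliffordZr -ipe -clifford_rel cliffordDr; by rewrite addrK.
  rewrite (eq_bigr _ (fun j _ => E j)) sumrB -2!clifford_sumr closed.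
  by rewrite !clifford0r subr0.
(* Here v is commuted past [e j] and then past [du j], after which v.s = 0 removes the last term. *)
have -> : \sum_j clifford v (clifford (e j) (clifford (du j) s)) =
    \sum_j (v.1 0 j *: clifford (du j) s - (2 * ip v (du j)) *: clifford (e j) s).
  apply: eq_bigr => j _.
  have E1 := clifford_rel (e j) v (clifford (du j) s).
  have E2 := clifford_rel v (du j) s.
  have := cliffordZr (2 * ip v (du j)) (e j) s.
  rewrite -E2 cliffordDr vs.
  rewrite !clifford0r addr0 => <-.
  by rewrite -ipe -E1 addrAC subrr add0r.
apply/eqP; rewrite opprD addrA addrAC -!sumrN -!big_split /= big1// => j _.
(* [Hj] trades dv_j.s for - v.ds_j, and the summands then cancel for each j. *)
have -> : clifford (v.1 0 j *: du j - u.1 0 j *: dv j) s =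
   v.1 0 j *: clifford (du j) s + u.1 0 j *: clifford v (ds j).
  rewrite cliffordDl -scaleNr !cliffordZl scaleNr -scalerN; congr (_ + _ *: _).
  by apply/eqP; rewrite eqr_oppLR -addr_eq0 Hj.
by rewrite cliffordZl scaleNr; apply/ffunP => S; rewrite !ffunE; ring.
Qed.

Section LocalFlow.
Variables (R : realType) (U : set 'rV[R]_(1 + 5)).
Variables (v u : 'rV[R]_(1 + 5) -> gvec R 5) (s : 'rV[R]_(1 + 5) -> extform R 5).
(** In the application [s] is a member of the pencil, [nu] the density phi(rho), and [U] consists of
    all times over the image of a chart. *)
Variable nu : 'rV[R]_(1 + 5) -> R.
Local Notation e j := (delta_mx 0 j : 'rV[R]_(1 + 5)).
Local Notation dx j := ((0, delta_mx 0 j) : gvec R 5).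
Local Notation us := (fun y => clifford (u y) (s y)).
Hypothesis openU : open U.
Hypothesis even_s : forall y, U y -> even_form (s y).
Hypothesis diff_s : forall y, U y -> diff_form s y.
Hypothesis diff_v : forall y, U y -> diff_gen v y.
Hypothesis diff_u : forall y, U y -> diff_gen u y.
Hypothesis nu_neq0 : forall y, U y -> nu y != 0.
Hypothesis v_neq0 : forall y, U y -> v y != 0.
Hypothesis quad_s : forall y, U y -> quad (s y) = nu y *: v y.
Hypothesis ip_uv : forall y, U y -> ip (u y) (v y) = 0.
Hypothesis ip_uu : forall y, U y -> ip (u y) (u y) = 2.
Hypothesis closed_s : forall y, U y ->
  \sum_j clifford (dx j) (Dform (e (space_idx j)) s y) = 0.
Hypothesis flow_s : forall y, U y ->
  Dform (e (time_idx 5)) s y = \sum_j clifford (dx j) (Dform (e (space_idx j)) us y).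

Lemma nearU (P : 'rV[R]_(1 + 5) -> Prop) y : U y -> (forall z, U z -> P z) ->
  \forall z \near y, P z.
Proof.
by move=> Uy PU; apply: filterS PU _; exact: open_nbhs_nbhs.
Qed.

Lemma clifford_vs y : U y -> clifford (v y) (s y) = 0.
Proof.
move=> Uy; have := clifford_quad (even_s Uy); rewrite quad_s// cliffordZl => /eqP.
by rewrite scaler_eq0 (negbTE (nu_neq0 Uy)) => /eqP.
Qed.

Lemma Dclifford_vs y k : U y ->
  clifford (Dgen k v y) (s y) + clifford (v y) (Dform k s y) = 0.
Proof.
move=> Uy; rewrite -Dform_clifford; [|exact: diff_v|exact: diff_s].
by rewrite (@Dform_near R _ 5 k _ (fun=> 0)) ?Dform_cst//; exact/nearU/clifford_vs.
Qed.

Lemma ip_uDv k y : U y -> ip (Dgen k u y) (v y) = - ip (u y) (Dgen k v y).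
Proof.
move=> Uy; apply/eqP; rewrite -addr_eq0 -derive_ip; [|exact: diff_u|exact: diff_v].
apply/eqP; rewrite (near_eq_derive (g := fun=> 0)) ?derive_cst//; exact/nearU/ip_uv.
Qed.

Lemma ip_vv y : U y -> ip (v y) (v y) = 0.
Proof.
move=> Uy; have := ip_quad_quad (even_s Uy); rewrite quad_s// ipZl ipZr => H.
by do 2 apply: (mulfI (nu_neq0 Uy)); rewrite H !mulr0.
Qed.

(* [quad us = -2 quad s], and the vector part of [quad s] is divergence free
   because [s] is closed. *)
Lemma mukai_us_flow y : U y -> mukai (us y) (Dform (e (time_idx 5)) s y) = 0.
Proof.
move=> Uy; rewrite flow_s//.
have diff_us : diff_form us y by apply: diff_clifford; [exact: diff_u|exact: diff_s].
have diff_c c F : diff_form F y -> diff_form (fun z => clifford c (F z)) y.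
  by move=> dF; apply: diff_clifford => //; exact: diff_gen_cst.
have quad_us z : U z -> quad (us z) = - (2 *: quad (s z)).
  move=> Uz; rewrite quad_clifford quad_s// ipZr ip_uv// ip_uu//.
  by rewrite !mulr0 scale0r sub0r.
have E j : mukai (us y) (clifford (dx j) (Dform (e (space_idx j)) us y)) =
    - (2 * mukai (s y) (clifford (dx j) (Dform (e (space_idx j)) s y))).
  (* The two terms of the product rule agree by self-adjointness. *)
  have D F : diff_form F y ->
      'D_(e (space_idx j)) (fun z => mukai (clifford (dx j) (F z)) (F z)) y =
      2 * mukai (F y) (clifford (dx j) (Dform (e (space_idx j)) F y)).
    move=> dF; rewrite derive_mukai//; last exact: diff_c.
    rewrite (@Dform_clifford _ _ _ _ (fun=> dx j)) //.
    rewrite Dgen_cst clifford_adj (mukaiC (_ + _)).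
    by rewrite clifford0l add0r; ring.
  have D1 := D _ diff_us; have D2 := D _ (diff_s Uy).
  have : 'D_(e (space_idx j)) (fun z => mukai (clifford (dx j) (us z)) (us z)) y =
     - (2 * 'D_(e (space_idx j)) (fun z => mukai (clifford (dx j) (s z)) (s z)) y).
    rewrite -mulNr -deriveMl; last first.
      by apply/diff_derivable/diff_mukai; [exact/diff_c/diff_s|exact: diff_s].
    apply: near_eq_derive; apply: (nearU Uy) => z Uz /=.
    by rewrite -!quadP quad_us// ipNl ipZl mulNr.
  by rewrite D1 D2; move: (mukai _ _) (mukai _ _) => p q; lra.
(* Summed over j, the right side pairs s with ds = 0. *)
rewrite mukai_sumr (eq_bigr _ (fun j _ => E j)) sumrN -mulr_sumr -mukai_sumr closed_s//.
by rewrite mukai0r mulr0 oppr0.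
Qed.

(** The time derivative of <u.s, s> = nu (u, v) = 0 is <u_t.s, s> + 2 <u.s, s_t>. The second term
    vanishes by [mukai_us_flow], and the first is nu (v, u_t). *)
Lemma ip_v_dtu y : U y -> ip (v y) (Dgen (e (time_idx 5)) u y) = 0.
Proof.
move=> Uy.
have diff_us : diff_form us y by apply: diff_clifford; [exact: diff_u|exact: diff_s].
have : 'D_(e (time_idx 5)) (fun z => mukai (us z) (s z)) y = 0.
  rewrite (near_eq_derive (g := fun=> 0)) ?derive_cst//; apply: (nearU Uy) => z Uz.
  by rewrite -quadP quad_s// ipZl ipC ip_uv// mulr0.
rewrite derive_mukai//; last exact: diff_s.
rewrite mukai_us_flow// addr0 Dform_clifford; [|exact: diff_u|exact: diff_s].
rewrite mukaiDl (clifford_adj (u y)) (mukaiC (Dform _ s y)) mukai_us_flow// addr0.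
rewrite -quadP quad_s// ipZl => /eqP.
by rewrite mulf_eq0 (negbTE (nu_neq0 Uy)) => /eqP.
Qed.

Local Notation V := (fun y => lift_gvec (v y)).
Local Notation W := (fun y => wvec (u y)).

Lemma courant_VW y : U y -> exists k : R, courant V W y = k *: V y.
Proof.
move=> Uy.
rewrite courant_lift_wvec; [|exact: diff_v|exact: diff_u].
have v0u : ip (Dgen (e (time_idx 5)) v y) (u y) = 0.
  by rewrite ipC -[LHS]opprK -ip_uDv// ipC ip_v_dtu// oppr0.
rewrite ip_v_dtu// v0u subr0 scale0r sub0r.
set d := (X in lift_gvec X).
have ds : clifford d (s y) = 0.
  rewrite /d.
  (* Differentiating (u, v) = 0 identifies the two inner products up to sign. *)
  have -> : \row_j (ip (Dgen (e (space_idx j)) v y) (u y) - ip (v y) (Dgen (e (space_idx j)) u y)) =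
      \row_j - (2 * ip (v y) (Dgen (e (space_idx j)) u y)).
    apply/rowP => j; rewrite !mxE (ipC (v y)) ip_uDv// (ipC (u y)); ring.
  apply: (@bracket_kills _ _ _ _ _ _ (Dform (e (time_idx 5)) s y) _ _
    (fun j => Dform (e (space_idx j)) s y)).
  - by move=> j; exact: Dclifford_vs.
  - exact: Dclifford_vs.
  - exact: clifford_vs.
  - exact: closed_s.
  - rewrite flow_s//; apply: eq_bigr => j _.
    by rewrite Dform_clifford//; [exact: diff_u|exact: diff_s].
have [|k ->] := annihilator ds.
  by rewrite quad_s// scaler_eq0 negb_or nu_neq0// v_neq0.
exists (- (k * nu y)); rewrite quad_s// scalerA scaleNr; congr (- _).
by congr pair; rewrite /= scale_row_mx scaler0.
Qed.

(** Lifted vectors have no time component while w has time component 1, so a linear relation would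
    force v = 0. *)
Lemma local_rank y : U y -> \dim <<[:: V y; W y]>>%VS = 2%N.
Proof.
move=> Uy; suff /eqP -> : free [:: V y; W y] by [].
rewrite free_cons seq1_free span_seq1; apply/andP; split; last first.
  by apply: contra_eq_neq (wvec1t (u y)) => ->; rewrite mxE eq_sym oner_eq0.
apply: contraNN (v_neq0 Uy) => /vlineP[k Vk].
have k0 : k = 0 by have := lift1t (v y); rewrite Vk mxE wvec1t mulr1.
by apply/eqP; rewrite -(proj_lift (v y)) Vk k0 scale0r proj_gvec0.
Qed.

Lemma local_isotropic y a b : U y ->
  a \in <<[:: V y; W y]>>%VS -> b \in <<[:: V y; W y]>>%VS -> ip a b = 0.
Proof.
move=> Uy; rewrite span_cons span_seq1.
move=> /memv_addP[_ /vlineP[k ->] [_ /vlineP[l ->] ->]].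
move=> /memv_addP[_ /vlineP[k' ->] [_ /vlineP[l' ->] ->]].
have VV : ip (V y) (V y) = 0 by rewrite ip_liftl proj_lift ip_vv.
have VW : ip (V y) (W y) = 0 by rewrite ip_lift_wvec ipC ip_uv// oppr0.
have WW : ip (W y) (W y) = 0 by rewrite ip_wvec ip_uu// subrr.
move: (V y) (W y) VV VW WW => V0 W0 VV VW WW.
by rewrite !(ipDl, ipDr, ipZl, ipZr) (ipC W0) VV VW WW; ring.
Qed.

Lemma local_integrable y a b : U y ->
  (forall z, U z -> a z \in <<[:: V z; W z]>>%VS) ->
  (forall z, U z -> b z \in <<[:: V z; W z]>>%VS) ->
  diff_gen a y -> diff_gen b y -> courant a b y \in <<[:: V y; W y]>>%VS.
Proof.
move=> Uy aE bE da db.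
have dV := diff_lift (diff_v Uy); have dW := diff_wvec (diff_u Uy).
have V0 z : U z -> (V z).1 0 (time_idx 5) = 0 by move=> _; exact: lift1t.
have W1 z : U z -> (W z).1 0 (time_idx 5) = 1 by move=> _; exact: wvec1t.
have Vn0 : V y != 0.
  by apply: contraNneq (v_neq0 Uy) => Vy; rewrite -(proj_lift (v y)) Vy proj_gvec0.
have [f [g [df dg afg]]] := span_coefs openU Uy aE V0 W1 Vn0 da dV dW.
have [f' [g' [df' dg' bfg]]] := span_coefs openU Uy bE V0 W1 Vn0 db dV dW.
have iso c d := @local_isotropic y c d Uy.
have VE : V y \in <<[:: V y; W y]>>%VS by rewrite memv_span// !inE eqxx.
have WE : W y \in <<[:: V y; W y]>>%VS by rewrite memv_span// !inE eqxx orbT.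
have := courant_comb da db dV dW df dg df' dg' afg bfg
  (iso _ _ VE VE) (iso _ _ VE WE) (iso _ _ WE WE).
apply: subvP; apply/span_subvP => z; rewrite !inE => /or3P[]/eqP-> //.
by have [k ->] := courant_VW Uy; exact: memvZ.
Qed.

End LocalFlow.

(** * The derivative of the volume *)

Section Hat.
Variable R : realType.
Implicit Types (rho hat drho : (extform R 5 * extform R 5)%type) (v : gvec R 5).

Lemma is_derive_quartic_poly (c0 c1 c2 c3 c4 : R) :
  is_derive (0 : R) (1 : R) (fun e : R => c0 + e * (c1 + e * (c2 + e * (c3 + e * c4)))) c1.
Proof.
apply: is_derive_eq.
by rewrite !mul0r !addr0 add0r mul1r scale0r add0r /GRing.scale/= mulr1.
Qed.

Lemma volE rho : quartic rho < 0 -> vol rho ^+ 2 = - quartic rho.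
Proof. by move=> q0; rewrite /vol sqr_sqrtr// ltr0_norm. Qed.

Lemma vol_gt0 rho : quartic rho < 0 -> 0 < vol rho.
Proof. by move=> q0; rewrite /vol sqrtr_gt0 normr_gt0 lt_eqF. Qed.

(** Differentiating the square root is avoided: the square of [vol] is minus [quartic] near e = 0,
    and both sides are differentiated there. *)
Lemma derive_vol rho drho (l : R) : quartic rho < 0 ->
  is_derive (0 : R) (1 : R) (fun e : R => vol (rho + e *: drho)) l ->
  vol rho * l = - (mukai (clifford (quad rho.2) rho.1) drho.1 +
                   mukai (clifford (quad rho.1) rho.2) drho.2).
Proof.
move=> q0 dvol.
pose f (e : R) := quartic (rho + e *: drho).
set B1 := bquad rho.1 drho.1; set B2 := bquad rho.2 drho.2.
pose c1 := 2 * (ip B1 (quad rho.2) + ip (quad rho.1) B2).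
have df : is_derive (0 : R) (1 : R) f c1.
  set Q1 := quad rho.1; set Q2 := quad rho.2; set P1 := quad drho.1; set P2 := quad drho.2.
  (* Q is quadratic along a line, so f is a quartic polynomial in e, written in Horner form, with
     linear coefficient [c1]. *)
  have -> : f = (fun e : R => ip Q1 Q2 + e * (c1 + e * ((ip Q1 P2 + 4 * ip B1 B2 + ip P1 Q2) +
      e * ((2 * ip B1 P2 + 2 * ip P1 B2) + e * ip P1 P2)))).
    apply/funext => e; rewrite /f /quartic /= !quad_pencil /vz -/Q1 -/Q2 -/B1 -/B2 -/P1 -/P2 /c1.
    by rewrite !(ipDl, ipDr, ipZl, ipZr); ring.
  exact: is_derive_quartic_poly.
have f0 : f 0 = quartic rho by rewrite /f scale0r addr0.
(* Negativity is an open condition, so [volE] applies on a neighbourhood of 0. *)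
have nf : \forall e \near (0 : R), f e < 0.
  have : {for (0:R), continuous f} by apply/differentiable_continuous/derivable1_diffP/ex_derive.
  move=> /(_ [set z | z < 0]); apply; apply: open_nbhs_nbhs; split; first exact: open_lt.
  by rewrite f0.
have dg := is_deriveM dvol dvol.
have : is_derive (0 : R) (1 : R) (- f) (vol rho *: l + vol rho *: l).
  rewrite scale0r addr0 in dg.
  apply: (near_eq_is_derive _ dg).
  near=> e; rewrite [LHS]/GRing.mul /= -expr2 volE //.
  by near: e.
move=> [_ E1]; have [_ E2] := is_deriveN df.
move: E2; rewrite E1 /c1 /B1 /B2 (bquadP rho.1 drho.1) (ipC (quad rho.1)).
by rewrite (bquadP rho.2 drho.2) /GRing.scale/= => E; lra.
Unshelve. all: by end_near.
Qed.

(** Once phi is cancelled, [derive_vol] gives the pairings of hat with every even pair. Test pairs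
    with one zero component separate the two parts, and nondegeneracy determines them. *)
Lemma hat_clifford rho hat v1 v2 : even2 rho -> quartic rho < 0 -> is_hat rho hat ->
  quad rho.1 = vol rho *: v1 -> quad rho.2 = vol rho *: v2 ->
  hat = (clifford v1 rho.2, - clifford v2 rho.1).
Proof.
move=> [ev1 ev2] q0 [[od1 od2] H] Q1 Q2.
have v0 := vol_gt0 q0.
have key psi1 psi2 : even_form psi1 -> even_form psi2 ->
    mukai hat.2 psi1 - mukai hat.1 psi2 =
    - (mukai (clifford v2 rho.1) psi1 + mukai (clifford v1 rho.2) psi2).
  move=> e1 e2; apply: (mulfI (lt0r_neq0 v0)).
  rewrite (derive_vol q0 (H (psi1, psi2) (conj e1 e2))) Q1 Q2 !cliffordZl !mukaiZl /=; ring.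
have even0 : even_form (0 : extform R 5) by move=> S _; rewrite ffunE.
rewrite [LHS]surjective_pairing; congr pair.
  apply/eqP; rewrite -subr_eq0 -scaleN1r; apply/eqP; apply: mukai_even_nondeg.
    by move=> S oS; rewrite ffunE od1// add0r ffunE (clifford_parity v1 ev2 oS) scaler0.
  move=> psi epsi; have := key 0 psi even0 epsi.
  by rewrite (mukaiDl hat.1) mukaiZl !mukai0r => E; lra.
apply/eqP; rewrite -addr_eq0; apply/eqP; apply: mukai_even_nondeg.
  by move=> S oS; rewrite ffunE od2// add0r (clifford_parity v2 ev1 oS).
move=> psi epsi; have := key psi 0 epsi even0.
by rewrite (mukaiDl hat.2) !mukai0r => E; lra.
Qed.

End Hat.

(** * Pointwise algebra of the pencil rho1 + z rho2 *)

Section PencilAlgebra.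
Variables (R : realType) (s1 s2 : extform R 5) (v1 h v2 : gvec R 5) (k : R).
Hypothesis even_s1 : even_form s1.
Hypothesis even_s2 : even_form s2.
Hypothesis k0 : k != 0.
Hypothesis quadE : forall z : R, quad (s1 + z *: s2) = k *: vz z v1 h v2.

Lemma pencil_quad1 : quad s1 = k *: v1.
Proof.
by have := quadE 0; rewrite /vz scale0r addr0 mulr0 expr0n !scale0r !addr0.
Qed.

Lemma pencil_quad2 : quad s2 = k *: v2.
Proof.
apply: ip_ext => c.
(* Adding the values at 1 and -1 removes the middle coefficients. *)
have E1 := congr1 (fun a => ip a c) (quadE 1); have E2 := congr1 (fun a => ip a c) (quadE (-1)).
move: E1 E2; rewrite !quad_pencil pencil_quad1 /vz !(ipDl, ipZl) => *; lra.
Qed.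

Lemma pencil_null z : ip (vz z v1 h v2) (vz z v1 h v2) = 0.
Proof.
have := ip_quad_quad (even_formD z even_s1 even_s2); rewrite quadE ipZl ipZr => H.
by do 2 apply: (mulfI k0); rewrite H !mulr0.
Qed.

(** The identity v(z).(s1 + z s2) = 0 is a cubic in z; its four coefficients are recovered from the
    values at 0, 1, -1 and 2. *)
Lemma pencil_clifford : [/\ clifford v1 s1 = 0, clifford v2 s2 = 0,
  clifford v1 s2 = - (2 *: clifford h s1) & clifford v2 s1 = - (2 *: clifford h s2)].
Proof.
have H z : clifford (vz z v1 h v2) (s1 + z *: s2) = 0.
  have := clifford_quad (even_formD z even_s1 even_s2); rewrite quadE cliffordZl => /eqP.
  by rewrite scaler_eq0 (negbTE k0) => /eqP.
move: H; rewrite /vz => H.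
have {}H z : clifford v1 s1 + z *: clifford v1 s2 + (2 * z) *: (clifford h s1 + z *: clifford h s2)
    + z ^+ 2 *: (clifford v2 s1 + z *: clifford v2 s2) = 0.
  by rewrite -(H z) !cliffordDl !cliffordZl !cliffordDr !cliffordZr.
move: (clifford v1 s1) (clifford v1 s2) (clifford h s1) (clifford h s2) H.
move: (clifford v2 s1) (clifford v2 s2) => a5 a6 a1 a2 a3 a4 H.
have E z S := congr1 (fun f : extform R 5 => f S) (H z).
split; apply/ffunP => S; move: (E 0 S) (E 1 S) (E (-1) S) (E 2 S);
  by rewrite !ffunE /GRing.scale/= => *; lra.
Qed.

End PencilAlgebra.

(** * The flow on the manifold *)

(** A directional derivative only sees the restriction to a line, so derivatives on the cylinder can
    be read on a time slice or along a time curve. *)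
Lemma derive_reparam (R : realType) (V V' : normedModType R) (f : V -> R) (g : V' -> R) v w x y :
  (forall k : R, f (k *: v + x) = g (k *: w + y)) -> 'D_v f x = 'D_w g y.
Proof.
move=> fg; have fx : f x = g y by have := fg 0; rewrite !scale0r !add0r.
rewrite /derive (_ : (fun h => _) = (fun h => h^-1 *: ((g \o shift y) (h *: w) - g y)))//.
by apply/funext => k /=; rewrite fg fx.
Qed.

Section Joint.
Variables (R : realType) (n : nat).
Implicit Types (y : 'rV[R]_(1 + n)).

Lemma derive_space (F : R -> 'rV[R]_n -> R) j y :
  'D_(delta_mx 0 (space_idx j)) (fun y => F (time y) (Defs.space y)) y =
  'D_(delta_mx 0 j) (F (time y)) (Defs.space y).
Proof.
apply: derive_reparam => k.
have -> : time (k *: delta_mx 0 (space_idx j) + y) = time y.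
  by rewrite /time /space_idx !mxE eq_lrshift andbF mulr0 add0r.
congr (F _ _).
by apply/rowP => i; rewrite /Defs.space /space_idx !mxE (inj_eq (@rshift_inj 1 n)).
Qed.

Lemma derive_time (F : R -> 'rV[R]_n -> R) y :
  'D_(delta_mx 0 (time_idx n)) (fun y => F (time y) (Defs.space y)) y =
  derive1 (fun t => F t (Defs.space y)) (time y).
Proof.
rewrite derive1E; apply: derive_reparam => k.
have -> : Defs.space (k *: delta_mx 0 (time_idx n) + y) = Defs.space y.
  by apply/rowP => i; rewrite /Defs.space /time_idx !mxE eq_rlshift andbF mulr0 add0r.
by congr (F _ _); rewrite /time /time_idx !mxE !eqxx.
Qed.

Lemma open_space (A : set 'rV[R]_n) : open A -> open [set y : 'rV[R]_(1 + n) | A (Defs.space y)].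
Proof. by apply: open_comp => y _; exact: continuous_rsubmx. Qed.

Lemma Dform_space (F : R -> 'rV[R]_n -> extform R 5) j y :
  Dform (delta_mx 0 (space_idx j)) (fun y => F (time y) (Defs.space y)) y =
  Dform (delta_mx 0 j) (F (time y)) (Defs.space y).
Proof. by apply/ffunP => S; rewrite !ffunE (derive_space (fun t x => F t x S)). Qed.

End Joint.

Section Linear.
Variables (R : realType) (m n : nat).

Lemma Dform_comb (a b : R) e (F G : 'rV[R]_m -> extform R n) x :
  diff_form F x -> diff_form G x ->
  Dform e (fun y => a *: F y + b *: G y) x = a *: Dform e F x + b *: Dform e G x.
Proof.
move=> dF dG; apply/ffunP => S; rewrite !ffunE.
under eq_fun do rewrite !ffunE.
have dFS : derivable (fun y => F y S : R) x e by exact: diff_derivable.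
have dGS : derivable (fun y => G y S : R) x e by exact: diff_derivable.
rewrite (@deriveD _ _ _ (fun y => a *: F y S) (fun y => b *: G y S)); [|exact: derivableZ..].
by rewrite !deriveZ.
Qed.

Lemma diff_form_comb (a b : R) (F G : 'rV[R]_m -> extform R n) x :
  diff_form F x -> diff_form G x -> diff_form (fun y => a *: F y + b *: G y) x.
Proof.
move=> dF dG S; under eq_fun do rewrite !ffunE.
by apply: (@differentiableD _ _ _ (fun y => a *: F y S)); exact: differentiableZ.
Qed.

Lemma diff_gen_comb3 (a b c : R) (A B C : 'rV[R]_m -> gvec R n) x :
  diff_gen A x -> diff_gen B x -> diff_gen C x ->
  diff_gen (fun y => a *: A y + b *: B y + c *: C y) x.
Proof.
move=> dA dB dC; have dc k : differentiable (fun=> k : R) x by exact: differentiable_cst.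
by do 2?apply: diff_genD; apply: diff_genZ.
Qed.

End Linear.

Lemma img_cylinder (R : realType) (n : nat) (M : charted R n) i y :
  @img R (1 + n) (cylinder M) i y <-> img (M := M) i (Defs.space y).
Proof.
split.
  by case=> -[t p] /= ip <-; exists p => //; rewrite /Defs.space row_mxKr.
case=> p ip py; exists (time y, p) => //=.
rewrite -[RHS]hsubmxK py; congr row_mx.
by apply/rowP => j; rewrite !mxE (ord1 j) /time mxE.
Qed.

Lemma diff_gen_section (R : realType) (n : nat) (M : charted R n) (a : gen_field M) i x :
  gen_section a -> img i x -> diff_gen (a i) x.
Proof.
move=> [_ sm] ix k; have [s1 s2] := sm i k.
by have [d1 _] := s1 1%N; have [d2 _] := s2 1%N; split; [exact: d1|exact: d2].
Qed.

Section Flow.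
Variables (R : realType) (M : charted R 5).
Variables (rho1 rho2 hat1 hat2 : R -> form_field M) (v1 h v2 : R -> gen_field M).
Hypothesis M_smooth : smooth_manifold M.
Hypothesis rho1_family : form_family rho1.
Hypothesis rho2_family : form_family rho2.
Hypothesis rho_even : forall t i x, img i x -> even2 (rho1 t i x, rho2 t i x).
Hypothesis rho1_closed : forall t, closed_field (rho1 t).
Hypothesis rho2_closed : forall t, closed_field (rho2 t).
Hypothesis rho_neg : forall t i x, img i x -> quartic (rho1 t i x, rho2 t i x) < 0.
Hypothesis rho_hat : forall t i x, img i x ->
  is_hat (rho1 t i x, rho2 t i x) (hat1 t i x, hat2 t i x).
Hypothesis flow1 : forall t i x S, img i x ->
  derive1 (fun s : R => rho1 s i x S : R) t = ext_d (hat1 t i) x S.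
Hypothesis flow2 : forall t i x S, img i x ->
  derive1 (fun s : R => rho2 s i x S : R) t = ext_d (hat2 t i) x S.
Hypothesis v1_family : gen_family v1.
Hypothesis h_family : gen_family h.
Hypothesis v2_family : gen_family v2.
Hypothesis v1hv2_def : forall t i x (z : R), img i x ->
  quad (rho1 t i x + z *: rho2 t i x) =
  vol (rho1 t i x, rho2 t i x) *: vz z (v1 t i x) (h t i x) (v2 t i x).

Local Notation joint F i := (fun y => F (time y) i (Defs.space y)).
Local Notation chart_dom i := [set y : 'rV[R]_(1 + 5) | img (M := M) i (Defs.space y)].

Lemma vol_neq0 t i x : img i x -> vol (rho1 t i x, rho2 t i x) != 0.
Proof. by move=> ix; exact/lt0r_neq0/vol_gt0/rho_neg. Qed.

Lemma hat_eq t i x : img i x -> hat1 t i x = clifford (v1 t i x) (rho2 t i x) /\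
  hat2 t i x = (-1) *: clifford (v2 t i x) (rho1 t i x).
Proof.
move=> ix; have k0 := vol_neq0 t ix.
have Q := @v1hv2_def t i x ^~ ix.
have Q1 := pencil_quad1 Q; have Q2 := pencil_quad2 Q.
have := hat_clifford (rho_even t ix) (rho_neg t ix) (rho_hat t ix) Q1 Q2.
by move=> -[-> ->]; rewrite scaleN1r.
Qed.

(** Here phi^2 = - f, while f = phi^2 (v1, v2). *)
Lemma ip_v12 t i x : img i x -> ip (v1 t i x) (v2 t i x) = -1.
Proof.
move=> ix; have k0 := vol_neq0 t ix.
have Q := @v1hv2_def t i x ^~ ix.
have := volE (rho_neg t ix); rewrite /quartic/= (pencil_quad1 Q) (pencil_quad2 Q).
rewrite ipZl ipZr => E; apply: (mulfI (mulf_neq0 k0 k0)); lra.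
Qed.

Lemma diff_gen_family (a : R -> gen_field M) i y : gen_family a ->
  chart_dom i y -> diff_gen (joint a i) y.
Proof.
move=> [_ sm] Uy k; have [s1 s2] := sm i k.
by have [d1 _] := s1 1%N; have [d2 _] := s2 1%N; split; [exact: d1|exact: d2].
Qed.

Lemma diff_form_family (phi : R -> form_field M) i y : form_family phi ->
  chart_dom i y -> diff_form (joint phi i) y.
Proof. by move=> [_ sm] Uy S; have [d1 _] := sm i S 1%N; exact: d1. Qed.

Lemma closed_joint (phi : R -> form_field M) i y : (forall t, closed_field (phi t)) ->
  chart_dom i y ->
  \sum_j clifford (0, delta_mx 0 j) (Dform (delta_mx 0 (space_idx j)) (joint phi i) y) = 0.
Proof.
move=> cl Uy; rewrite -[RHS](cl (time y) i (Defs.space y))// ext_dE.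
by apply: eq_bigr => j _; rewrite (Dform_space (fun t x => phi t i x)).
Qed.

(** On the open chart domain psi agrees with F, so its space derivatives are those of F. It is
    applied with psi a hat field and F its Clifford expression, whose differentiability is known. *)
Lemma flow_joint (phi psi : R -> form_field M) (F : 'rV[R]_(1 + 5) -> extform R 5) i y :
  (forall t x S, img i x -> derive1 (fun s : R => phi s i x S : R) t = ext_d (psi t i) x S) ->
  (forall z, chart_dom i z -> psi (time z) i (Defs.space z) = F z) -> chart_dom i y ->
  Dform (delta_mx 0 (time_idx 5)) (joint phi i) y =
  \sum_j clifford (0, delta_mx 0 j) (Dform (delta_mx 0 (space_idx j)) F y).
Proof.
move=> fl psiF Uy; apply/ffunP => S.
rewrite ffunE (derive_time (fun t x => phi t i x S)) fl// ext_dE !sum_ffunE.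
apply: eq_bigr => j _; congr (clifford _ _ _).
rewrite -(Dform_space (fun t x => psi t i x)); apply: Dform_near.
have oU : open (chart_dom i) by apply: open_space; exact: open_img M_smooth i.
by apply: filterS (open_nbhs_nbhs (conj oU Uy)) => z; exact: psiF.
Qed.

(** The argument common to all parameter values: (a, b) is (1, z) for nonzero z, (1, 0) for z = 0
    and (0, 1) for z = oo. As combinations of v1, h, v2 with constant coefficients, v and u inherit
    differentiability. *)
Lemma spanE_isotropic_integrable (a b : R) (v u : R -> gen_field M) (al be ga al' be' ga' : R) :
  (forall t i x, v t i x = al *: v1 t i x + be *: h t i x + ga *: v2 t i x) ->
  (forall t i x, u t i x = al' *: v1 t i x + be' *: h t i x + ga' *: v2 t i x) ->
  (forall t i x, img i x -> quad (a *: rho1 t i x + b *: rho2 t i x) =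
     vol (rho1 t i x, rho2 t i x) *: v t i x) ->
  (forall t i x, img i x -> clifford (u t i x) (a *: rho1 t i x + b *: rho2 t i x) =
     a *: hat1 t i x + b *: hat2 t i x) ->
  (forall t i x, img i x -> v t i x != 0) ->
  (forall t i x, img i x -> ip (u t i x) (v t i x) = 0) ->
  (forall t i x, img i x -> ip (u t i x) (u t i x) = 2) ->
  [/\ has_rank 2 (spanE v u), isotropic (spanE v u) & courant_integrable (spanE v u)].
Proof.
move=> vE uE quad_s us_hat v0 uv uu.
have open_U i : open (chart_dom i) by apply: open_space; exact: open_img M_smooth i.
pose s i : 'rV[R]_(1 + 5) -> extform R 5 := fun y => a *: joint rho1 i y + b *: joint rho2 i y.
have ev i y : chart_dom i y -> even_form (s i y).
  move=> Uy S oS; have [e1 e2] := rho_even (time y) Uy.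
  by rewrite !ffunE e1// e2// !scaler0 addr0.
have d1 i y := @diff_form_family rho1 i y rho1_family.
have d2 i y := @diff_form_family rho2 i y rho2_family.
have ds i y : chart_dom i y -> diff_form (s i) y.
  by move=> Uy; apply: diff_form_comb; [exact: d1|exact: d2].
have dgen (w : R -> gen_field M) k1 k2 k3 i y :
    (forall t i x, w t i x = k1 *: v1 t i x + k2 *: h t i x + k3 *: v2 t i x) ->
    chart_dom i y -> diff_gen (joint w i) y.
  move=> wE Uy; under eq_fun do rewrite wE.
  by apply: diff_gen_comb3; apply: diff_gen_family.
have dv i y : chart_dom i y -> diff_gen (joint v i) y := dgen _ _ _ _ _ _ vE.
have du i y : chart_dom i y -> diff_gen (joint u i) y := dgen _ _ _ _ _ _ uE.
have vol0 i y : chart_dom i y -> vol (joint rho1 i y, joint rho2 i y) != 0.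
  by move=> Uy; exact: vol_neq0.
have cl i y : chart_dom i y ->
    \sum_j clifford (0, delta_mx 0 j) (Dform (delta_mx 0 (space_idx j)) (s i) y) = 0.
  move=> Uy.
  pose D phi := \sum_(j < 5) clifford (0, delta_mx 0 j) (Dform (delta_mx 0 (space_idx j)) phi y).
  transitivity (a *: D (joint rho1 i) + b *: D (joint rho2 i)).
    rewrite !scaler_sumr -big_split; apply: eq_bigr => j _ /=.
    by rewrite Dform_comb ?cliffordDr ?cliffordZr//; [exact: d1|exact: d2].
  by rewrite /D !closed_joint// !scaler0 addr0.
pose h1 i : 'rV[R]_(1 + 5) -> extform R 5 := fun y => clifford (joint v1 i y) (joint rho2 i y).
pose h2 i : 'rV[R]_(1 + 5) -> extform R 5 :=
  fun y => (-1) *: clifford (joint v2 i y) (joint rho1 i y).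
have dh1 i y : chart_dom i y -> diff_form (h1 i) y.
  by move=> Uy; apply: diff_clifford; [exact: diff_gen_family|exact: d2].
have dh2 i y : chart_dom i y -> diff_form (h2 i) y.
  move=> Uy S; rewrite /h2; under eq_fun do rewrite ffunE.
  by apply: differentiableZ; apply: diff_clifford; [exact: diff_gen_family|exact: d1].
(* Both flow equations combine linearly into s_t = d(u.s), because u.s = a hat1 + b hat2. *)
have fl i y : chart_dom i y -> Dform (delta_mx 0 (time_idx 5)) (s i) y =
    \sum_j clifford (0, delta_mx 0 j)
      (Dform (delta_mx 0 (space_idx j)) (fun y => clifford (joint u i y) (s i y)) y).
  move=> Uy; rewrite /s Dform_comb; [|exact: d1|exact: d2].
  rewrite (@flow_joint rho1 hat1 (h1 i))//; last 2 first.
  - by move=> t x S ix; exact: flow1.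
  - by move=> z Uz; have [] := hat_eq (time z) Uz.
  rewrite (@flow_joint rho2 hat2 (h2 i))//; last 2 first.
  - by move=> t x S ix; exact: flow2.
  - by move=> z Uz; have [] := hat_eq (time z) Uz.
  rewrite !scaler_sumr -big_split; apply: eq_bigr => j _ /=.
  rewrite -!cliffordZr -cliffordDr; congr (clifford _ _).
  rewrite -Dform_comb; [|exact: dh1|exact: dh2].
  apply: Dform_near; apply: filterS (open_nbhs_nbhs (conj (open_U i) Uy)) => z Uz.
  by rewrite us_hat//; have [-> ->] := hat_eq (time z) Uz.
have qs i y : chart_dom i y -> quad (s i y) = vol (joint rho1 i y, joint rho2 i y) *: joint v i y.
  by move=> Uy; exact: quad_s.
have vn i y : chart_dom i y -> joint v i y != 0 by move=> Uy; exact: v0.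
have uvn i y : chart_dom i y -> ip (joint u i y) (joint v i y) = 0 by move=> Uy; exact: uv.
have uun i y : chart_dom i y -> ip (joint u i y) (joint u i y) = 2 by move=> Uy; exact: uu.
split.
- move=> i y /img_cylinder Uy; exact: (@local_rank _ (chart_dom i) (joint v i) (joint u i) (vn i)).
- move=> i y /img_cylinder Uy c d.
  exact: (@local_isotropic _ (chart_dom i) (joint v i) (joint u i) (s i) _ (ev i) (vol0 i)
     (qs i) (uvn i) (uun i)).
move=> c d [gc cE] [gd dE] i y /img_cylinder Uy.
have iU z : chart_dom i z -> @img R (1 + 5) (cylinder M) i z by move=> Uz; apply/img_cylinder.
apply: (@local_integrable _ (chart_dom i) (joint v i) (joint u i) (s i) _ (open_U i) (ev i)
  (ds i) (dv i) (du i) (vol0 i) (vn i) (qs i) (uvn i) (uun i) (cl i) (fl i)) => //.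
- by move=> z Uz; apply: cE; exact: iU.
- by move=> z Uz; apply: dE; exact: iU.
- exact: (diff_gen_section gc (iU _ Uy)).
- exact: (diff_gen_section gd (iU _ Uy)).
Qed.

(** * The parameter values: nonzero, zero and infinite *)

Lemma flow_pencil (z : R) : z != 0 ->
  let v t i x := vz z (v1 t i x) (h t i x) (v2 t i x) in
  let u t i x := uz z (v1 t i x) (v2 t i x) in
  [/\ has_rank 2 (spanE v u), isotropic (spanE v u) & courant_integrable (spanE v u)].
Proof.
move=> z0 v u.
have pairing t i x (ix : img i x) := null_pencil (pencil_null
  (rho_even t ix).1 (rho_even t ix).2 (vol_neq0 t ix) (@v1hv2_def t i x ^~ ix)).
apply: (@spanE_isotropic_integrable 1 z v u 1 (2 * z) (z ^+ 2) z^-1 0 (- z)).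
- by move=> t i x; rewrite scale1r.
- by move=> t i x; rewrite scale0r addr0 scaleNr.
- by move=> t i x ix; rewrite scale1r v1hv2_def.
- move=> t i x ix; have [-> ->] := hat_eq t ix.
  (* As v1.rho1 = v2.rho2 = 0, only v1.rho2 - z v2.rho1 survives in u.s. *)
  have [E1 E2 _ _] := pencil_clifford (rho_even t ix).1 (rho_even t ix).2 (vol_neq0 t ix)
    (@v1hv2_def t i x ^~ ix).
  rewrite /u /uz !scale1r cliffordDl -scaleNr !cliffordZl !cliffordDr !cliffordZr E1 E2.
  rewrite /= add0r !scaler0 addr0 !scalerA mulVf// mulrN1 scale1r //.
- move=> t i x ix; apply/eqP => v0; have := ip_v12 t ix.
  have [_ _ E3 E4 _] := pairing t i x ix.
  (* That v(z) is nonzero follows from (v(z), v2) = (v1, v2) = -1. *)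
  have <- : ip (v t i x) (v2 t i x) = ip (v1 t i x) (v2 t i x).
    by rewrite /v /vz !(ipDl, ipZl) E3 E4; ring.
  by rewrite v0 ip0l => /eqP; rewrite eq_sym oppr_eq0 oner_eq0.
- move=> t i x ix; have [E1 E2 E3 E4 E5] := pairing t i x ix.
  rewrite /u /v /uz /vz !(ipBl, ipZl) !(ipDr, ipZr).
  rewrite (ipC (v2 t i x) (v1 t i x)) (ipC (v2 t i x) (h t i x)).
  by rewrite E1 E2 E3 E4; field.
- move=> t i x ix; have [E1 E2 E3 E4 E5] := pairing t i x ix.
  rewrite /u /uz !(ipBl, ipZl) !(ipBr, ipZr) (ipC (v2 t i x) (v1 t i x)).
  by rewrite E1 E3 ip_v12//; field.
Qed.

Lemma flow_pencil0 :
  let v t i x := vz 0 (v1 t i x) (h t i x) (v2 t i x) in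
  let u t i x := uz_at0 0 (h t i x) (v2 t i x) in
  [/\ has_rank 2 (spanE v u), isotropic (spanE v u) & courant_integrable (spanE v u)].
Proof.
move=> v u.
have pairing t i x (ix : img i x) := null_pencil (pencil_null
  (rho_even t ix).1 (rho_even t ix).2 (vol_neq0 t ix) (@v1hv2_def t i x ^~ ix)).
have vE t i x : v t i x = v1 t i x by rewrite /v /vz mulr0 expr0n !scale0r !addr0.
have uE t i x : u t i x = - (2 *: h t i x) by rewrite /u /uz_at0 mulr0 scale0r subr0.
apply: (@spanE_isotropic_integrable 1 0 v u 1 0 0 0 (-2) 0).
- by move=> t i x; rewrite vE scale1r !scale0r !addr0.
- by move=> t i x; rewrite uE !scale0r addr0 add0r scaleNr.
- by move=> t i x ix; rewrite scale1r v1hv2_def.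
- move=> t i x ix; have [-> _] := hat_eq t ix.
  (* Here u = - 2 h, and the coefficient of z in v(z).s = 0 gives - 2 h.rho1 = v1.rho2 = hat1. *)
  have [_ _ E3 _] := pencil_clifford (rho_even t ix).1 (rho_even t ix).2 (vol_neq0 t ix)
    (@v1hv2_def t i x ^~ ix).
  by rewrite uE !scale1r !scale0r !addr0 -scaleNr cliffordZl scaleNr E3.
- move=> t i x ix; apply/eqP => v0; have := ip_v12 t ix.
  by rewrite -vE v0 ip0l => /eqP; rewrite eq_sym oppr_eq0 oner_eq0.
- move=> t i x ix; have [_ E2 _ _ _] := pairing t i x ix.
  by rewrite uE vE ipNl ipZl ipC E2 mulr0 oppr0.
(* From 2 (h, h) = - (v1, v2) = 1 one gets (u, u) = 4 (h, h) = 2. *)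
- move=> t i x ix; have [_ _ _ _ E5] := pairing t i x ix.
  by rewrite uE ipNl ipNr ipZl ipZr; move: E5; rewrite ip_v12// => *; lra.
Qed.

Lemma flow_pencil_oo :
  let v t i x := vz_atoo 0 (v1 t i x) (h t i x) (v2 t i x) in
  let u t i x := uz_atoo 0 (v1 t i x) (h t i x) in
  [/\ has_rank 2 (spanE v u), isotropic (spanE v u) & courant_integrable (spanE v u)].
Proof.
move=> v u.
have pairing t i x (ix : img i x) := null_pencil (pencil_null
  (rho_even t ix).1 (rho_even t ix).2 (vol_neq0 t ix) (@v1hv2_def t i x ^~ ix)).
have vE t i x : v t i x = v2 t i x by rewrite /v /vz_atoo mulr0 expr0n !scale0r !add0r.
have uE t i x : u t i x = 2 *: h t i x by rewrite /u /uz_atoo mulr0 scale0r add0r.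
apply: (@spanE_isotropic_integrable 0 1 v u 0 0 1 0 2 0).
- by move=> t i x; rewrite vE scale1r !scale0r !add0r.
- by move=> t i x; rewrite uE !scale0r addr0 add0r.
- move=> t i x ix; rewrite scale1r scale0r add0r vE; exact: pencil_quad2 (@v1hv2_def t i x ^~ ix).
- move=> t i x ix; have [_ ->] := hat_eq t ix.
  (* Here u = 2 h, and the coefficient of z^2 gives 2 h.rho2 = - v2.rho1 = hat2. *)
  have [_ _ _ E4] := pencil_clifford (rho_even t ix).1 (rho_even t ix).2 (vol_neq0 t ix)
    (@v1hv2_def t i x ^~ ix).
  by rewrite uE !scale1r !scale0r !add0r cliffordZl E4 scaleN1r opprK.
- move=> t i x ix; apply/eqP => v0; have := ip_v12 t ix.
  by rewrite -vE v0 ipC ip0l => /eqP; rewrite eq_sym oppr_eq0 oner_eq0.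
- move=> t i x ix; have [_ _ _ E4 _] := pairing t i x ix.
  by rewrite uE vE ipZl E4 mulr0.
- move=> t i x ix; have [_ _ _ _ E5] := pairing t i x ix.
  by rewrite uE ipZl ipZr; move: E5; rewrite ip_v12// => *; lra.
Qed.

End Flow.

Theorem proposition7 (R : realType) (M : charted R 5)
    (rho1 rho2 hat1 hat2 : R -> form_field M) (v1 h v2 : R -> gen_field M)
    (M_smooth : smooth_manifold M) (M_compact : compact [set: M])
    (M_oriented : oriented M)
    (* rho = (rho1, rho2) is a family of closed even forms *)
    (rho1_family : form_family rho1) (rho2_family : form_family rho2)
    (rho_even : forall t i x, img i x -> even2 (rho1 t i x, rho2 t i x))
    (rho1_closed : forall t, closed_field (rho1 t))
    (rho2_closed : forall t, closed_field (rho2 t))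
    (* lying at each point in an open orbit, of the type f(rho) < 0 *)
    (rho_open : forall t i x, img i x -> open_orbit (rho1 t i x, rho2 t i x))
    (rho_neg : forall t i x, img i x -> quartic (rho1 t i x, rho2 t i x) < 0)
    (* the flow d rho / dt = d rhohat, with rhohat = (hat1, hat2) *)
    (rho_hat : forall t i x, img i x ->
       is_hat (rho1 t i x, rho2 t i x) (hat1 t i x, hat2 t i x))
    (flow1 : forall t i x S, img i x ->
       derive1 (fun s : R => rho1 s i x S : R) t = ext_d (hat1 t i) x S)
    (flow2 : forall t i x S, img i x ->
       derive1 (fun s : R => rho2 s i x S : R) t = ext_d (hat2 t i) x S)
    (* Q(rho1 + z rho2) = phi(rho) (v1 + 2 z h + z^2 v2) *)
    (v1_family : gen_family v1) (h_family : gen_family h)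
    (v2_family : gen_family v2)
    (v1hv2_def : forall t i x (z : R), img i x ->
       quad (rho1 t i x + z *: rho2 t i x) =
       vol (rho1 t i x, rho2 t i x) *: vz z (v1 t i x) (h t i x) (v2 t i x)) :
  let v z t i x := vz z (v1 t i x) (h t i x) (v2 t i x) in
  let u z t i x := uz z (v1 t i x) (v2 t i x) in
  let u0 t i x := uz_at0 0 (h t i x) (v2 t i x) in
  let voo t i x := vz_atoo 0 (v1 t i x) (h t i x) (v2 t i x) in
  let uoo t i x := uz_atoo 0 (v1 t i x) (h t i x) in
  let good (E : gen_subbundle (cylinder M)) :=
    [/\ has_rank 2 E, isotropic E & courant_integrable E] in
  [/\ forall z : R, z != 0 -> good (spanE (v z) (u z)),
      good (spanE (v 0) u0)
    & good (spanE voo uoo)].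
Proof.
move=> v u u0 voo uoo good; split.
- by move=> z; apply: (@flow_pencil R M rho1 rho2 hat1 hat2 v1 h v2).
- by apply: (@flow_pencil0 R M rho1 rho2 hat1 hat2 v1 h v2).
- by apply: (@flow_pencil_oo R M rho1 rho2 hat1 hat2 v1 h v2).
Qed.
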